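(* Let $f:\mathbb{R}^d\to\mathbb{R}$, let ${\bm{x}}^\star$ be a local minimizer of $f$ with $f$ twice differentiable in a neighborhood of ${\bm{x}}^\star$, and let ${\bm{H}}:=\nabla^2 f({\bm{x}}^\star)$ satisfy ${\bm{H}}\succeq0$, ${\bm{H}}\neq{\bm{0}}$. Let ${\bm{P}}\succ0$ be a fixed symmetric positive definite matrix and let $\tilde\lambda_1\ge\cdots\ge\tilde\lambda_d\ge0$ be the eigenvalues of ${\bm{P}}^{-1}{\bm{H}}$, with $\lambda_{\max}({\bm{P}}^{-1}{\bm{H}}):=\tilde\lambda_1$. Consider Frozen ZO-Adam with step size $\eta>0$, $\beta_1\in[0,1)$ and smoothing parameter $\mu>0$ applied to $f_{\mathrm{quad}}({\bm{x}})=f({\bm{x}}^\star)+\tfrac12({\bm{x}}-{\bm{x}}^\star)^\top{\bm{H}}({\bm{x}}-{\bm{x}}^\star)$: \[ {\bm{m}}_{t+1}=\beta_1{\bm{m}}_t+(1-\beta_1)\widehat\nabla f_{\mathrm{quad}}({\bm{x}}_t),\qquad {\bm{x}}_{t+1}={\bm{x}}_t-\eta{\bm{P}}^{-1}{\bm{m}}_{t+1},\qquad{\bm{m}}_0={\bm{0}}, \] where $\widehat\nabla f_{\mathrm{quad}}({\bm{x}}_t)=\frac{f_{\mathrm{quad}}({\bm{x}}_t+\mu{\bm{u}}_t)-f_{\mathrm{quad}}({\bm{x}}_t-\mu{\bm{u}}_t)}{2\mu}{\bm{u}}_t$ with ${\bm{u}}_t\overset{\mathrm{i.i.d.}}{\sim}\mathcal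 N({\bm{0}},{\bm{I}}_d)$. Then $\eta^\star_{\mathrm{mean}}=2(1+\beta_1)/\bigl((1-\beta_1)\lambda_{\max}({\bm{P}}^{-1}{\bm{H}})\bigr)$. Moreover, if ${\bm{P}}{\bm{H}}={\bm{H}}{\bm{P}}$, the mean-square critical step size $\eta^\star_{\mathrm{ms}}$ is the unique $\eta>0$ satisfying \[ \eta\lambda_{\max}({\bm{P}}^{-1}{\bm{H}})<1+\beta_1\quad\text{and}\quad\sum_{i=1}^d\frac{\eta\tilde\lambda_i}{2\bigl(1-\frac{\eta\tilde\lambda_i}{1+\beta_1}\bigr)}=1, \] and it satisfies \[ \frac{2}{\Tr({\bm{P}}^{-1}{\bm{H}})+\frac{2\lambda_{\max}({\bm{P}}^{-1}{\bm{H}})}{1+\beta_1}}\le\eta^\star_{\mathrm{ms}}\le\frac{2}{\Tr({\bm{P}}^{-1}{\bm{H}})}. \]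
   Context: For an optimizer with step size $\eta$ applied to $f_{\mathrm{quad}}$ producing iterates $\{{\bm{x}}_t\}_{t\ge0}$ (with the auxiliary momentum initialized at ${\bm{0}}$), the critical step size in the mean is $\eta^\star_{\mathrm{mean}}:=\sup\{\eta>0:\ \forall {\bm{x}}_0\in\mathbb{R}^d,\ \sup_{t\ge0}\|\mathbb{E}[{\bm{x}}_t-{\bm{x}}^\star]\|<\infty\}$ and the mean-square critical step size is $\eta^\star_{\mathrm{ms}}:=\sup\{\eta>0:\ \forall {\bm{x}}_0\in\mathbb{R}^d,\ \sup_{t\ge0}\mathbb{E}\|{\bm{x}}_t-{\bm{x}}^\star\|^2<\infty\}$. The eigenvalues of ${\bm{P}}^{-1}{\bm{H}}$ are real and nonnegative since it is similar to ${\bm{P}}^{-1/2}{\bm{H}}{\bm{P}}^{-1/2}\succeq0$. *)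

(* Defs.v *)
From HB Require Import structures.
From mathcomp Require Import all_boot all_order all_algebra.
From mathcomp Require Import all_classical all_reals all_analysis.
Set Implicit Arguments. Unset Strict Implicit. Unset Printing Implicit Defensive.
Import Order.TTheory GRing.Theory Num.Theory.
Import numFieldNormedType.Exports.
Local Open Scope classical_set_scope.
Local Open Scope ring_scope.

Section Defs.
Variable R : realType.

Definition basis_vec d (i : 'I_d) : 'cV[R]_d := delta_mx i 0.

Definition partial d (f : 'cV[R]_d -> R) (i : 'I_d) (x : 'cV[R]_d) : R :=
  derive f x (basis_vec i).

Definition hessian d (f : 'cV[R]_d -> R) (x : 'cV[R]_d) : 'M[R]_d :=
  \matrix_(i, j) derive (partial f i) x (basis_vec j).

Definition twice_diff_near d (f : 'cV[R]_d -> R) (x : 'cV[R]_d) : Prop :=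
  \forall y \near x, differentiable f y /\ forall i, differentiable (partial f i) y.

Definition local_minimizer d (f : 'cV[R]_d -> R) (x : 'cV[R]_d) : Prop :=
  \forall y \near x, f x <= f y.

Definition qform d (A : 'M[R]_d) (v : 'cV[R]_d) : R := (trmx v *m A *m v) 0 0.

Definition psd d (A : 'M[R]_d) : Prop := forall v, 0 <= qform A v.
Definition spd d (A : 'M[R]_d) : Prop :=
  trmx A = A /\ forall v, v != 0 -> 0 < qform A v.

Definition enorm d (v : 'cV[R]_d) : R := Num.sqrt (\sum_i v i 0 ^+ 2).

Definition fquad d (fxs : R) (H : 'M[R]_d) (xs x : 'cV[R]_d) : R :=
  fxs + 2^-1 * qform H (x - xs).

Definition zo_grad d (g : 'cV[R]_d -> R) (mu : R) (x u : 'cV[R]_d) : 'cV[R]_d :=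
  ((g (x + mu *: u) - g (x - mu *: u)) / (2 * mu)) *: u.

Fixpoint zoadam_state d (fxs : R) (H Pc : 'M[R]_d) (xs : 'cV[R]_d)
  (eta beta1 mu : R) (x0 : 'cV[R]_d) (u : nat -> 'cV[R]_d) (t : nat)
  : 'cV[R]_d * 'cV[R]_d :=
  match t with
  | 0 => (x0, 0)
  | t'.+1 =>
    let: (x, m) := zoadam_state fxs H Pc xs eta beta1 mu x0 u t' in
    let m' := beta1 *: m + (1 - beta1) *: zo_grad (fquad fxs H xs) mu x (u t') in
    (x - eta *: (invmx Pc *m m'), m')
  end.

Definition mutually_independent dT (T : measurableType dT) (I : eqType)
  (P : probability T R) (X : I -> T -> R) : Prop :=
  forall (J : seq I) (B : I -> set R), uniq J -> (forall j, measurable (B j)) ->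
    P (\bigcap_(j in [set` J]) (X j @^-1` B j)) = (\prod_(j <- J) P (X j @^-1` B j))%E.

Definition std_normal dT (T : measurableType dT) (P : probability T R)
  (X : T -> R) : Prop :=
  forall A : set R, measurable A -> P (X @^-1` A) = normal_prob 0 1 A.

(* u_t = (u t i)_i, t : nat, are i.i.d. N(0, I_d): all coordinates u t i are
   measurable, mutually independent, and standard normal. *)
Definition iid_std_gaussian_dirs dT (T : measurableType dT) (P : probability T R)
  d (u : nat -> 'I_d -> T -> R) : Prop :=
  [/\ forall t i, measurable_fun setT (u t i),
      mutually_independent P (fun p : nat * 'I_d => u p.1 p.2)
    & forall t i, std_normal P (u t i)].

Definition dirs_at d dT (T : measurableType dT) (u : nat -> 'I_d -> T -> R)
  (w : T) : nat -> 'cV[R]_d := fun t => \col_i u t i w.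

Definition zoadam_x d dT (T : measurableType dT) (u : nat -> 'I_d -> T -> R)
  (fxs : R) (H Pc : 'M[R]_d) (xs : 'cV[R]_d) (eta beta1 mu : R)
  (x0 : 'cV[R]_d) (t : nat) (w : T) : 'cV[R]_d :=
  (zoadam_state fxs H Pc xs eta beta1 mu x0 (dirs_at u w) t).1.

Definition mean_bounded d dT (T : measurableType dT) (P : probability T R)
  (u : nat -> 'I_d -> T -> R) (fxs : R) (H Pc : 'M[R]_d) (xs : 'cV[R]_d)
  (eta beta1 mu : R) (x0 : 'cV[R]_d) : Prop :=
  (forall t i, ('E_P[(fun w => (zoadam_x u fxs H Pc xs eta beta1 mu x0 t w - xs) i 0)%R])%E
                 \is a fin_num) /\
  exists M : R, forall t,
    enorm (\col_i fine ('E_P[(fun w => (zoadam_x u fxs H Pc xs eta beta1 mu x0 t w - xs) i 0)%R])%E)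
    <= M.

Definition ms_bounded d dT (T : measurableType dT) (P : probability T R)
  (u : nat -> 'I_d -> T -> R) (fxs : R) (H Pc : 'M[R]_d) (xs : 'cV[R]_d)
  (eta beta1 mu : R) (x0 : 'cV[R]_d) : Prop :=
  exists M : R, forall t,
    ('E_P[(fun w => enorm (zoadam_x u fxs H Pc xs eta beta1 mu x0 t w - xs) ^+ 2)%R]
      <= M%:E)%E.

Definition eta_crit_mean d dT (T : measurableType dT) (P : probability T R)
  (u : nat -> 'I_d -> T -> R) (fxs : R) (H Pc : 'M[R]_d) (xs : 'cV[R]_d)
  (beta1 mu : R) : R :=
  sup [set eta : R | 0 < eta /\
        forall x0, mean_bounded P u fxs H Pc xs eta beta1 mu x0].

Definition eta_crit_ms d dT (T : measurableType dT) (P : probability T R)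
  (u : nat -> 'I_d -> T -> R) (fxs : R) (H Pc : 'M[R]_d) (xs : 'cV[R]_d)
  (beta1 mu : R) : R :=
  sup [set eta : R | 0 < eta /\
        forall x0, ms_bounded P u fxs H Pc xs eta beta1 mu x0].

Definition lam_max d (lam : 'I_d -> R) : R := \big[Num.max/0]_i lam i.

Definition ms_sum d (lam : 'I_d -> R) (beta1 eta : R) : R :=
  \sum_i (eta * lam i) / (2 * (1 - eta * lam i / (1 + beta1))).

End Defs.

(* Main.v *)
Require Import Defs.
From HB Require Import structures.
From mathcomp Require Import all_boot all_order all_algebra.
From mathcomp Require Import all_classical all_reals all_analysis.
From mathcomp Require Import measurable_realfun.
From mathcomp Require Import ring lra zify.
Set Implicit Arguments. Unset Strict Implicit. Unset Printing Implicit Defensive.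
Import Order.TTheory GRing.Theory Num.Theory.
Import numFieldNormedType.Exports.
Local Open Scope classical_set_scope.
Local Open Scope ring_scope.

(** Since [H] is a Hessian it is symmetric, so one step of the method reads
    [m' = beta m + (1 - beta) (u . H y) u], [y' = y - eta P^-1 m'] with [y = x - x*].

    Mean.  In a basis [Q] with [Q^T P Q = 1] and [Q^T H Q = diag lam], every coordinate
    of [E y] obeys [x_(t+1) = c x_t - beta x_(t-1)] with
    [c = 1 + beta - (1 - beta) eta lam_i].  The Schur-Cohn form
    [(1 + beta) (x_t^2 + x_(t-1)^2) - 2 c x_t x_(t-1)] is nonincreasing, and it is
    definite when [|c| < 1 + beta]; when [c < - (1 + beta)] the numbers [(-1)^t x_t] grow.

    Mean square.  If [P] and [H] commute, [K = P^-1 H] is symmetric, and in an orthonormal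
    eigenbasis of [K] the coordinates of [P y] and [z = eta m] have second moments
    [Y_i, C_i, N_i] that satisfy a closed linear recursion, coupled only through
    [S = \sum_j lam_j^2 Y_j] (fourth Gaussian moments).  There is a quadratic form [W_i] with
    [W_i' - W_i = g^2 (S - lam_i^2 Y_i / s_i)], where [g = (1 - beta) eta] and
    [s_i = eta lam_i / (2 (1 - eta lam_i / (1 + beta)))], so [L = \sum_i s_i W_i] satisfies
    [L' - L = g^2 (\sum_i s_i - 1) S].  Hence [S] is summable below the root of
    [\sum_i s_i = 1], while above it [L] grows at least linearly. *)

(** * Diagonalization of symmetric matrices *)

(** The mean-square threshold is the point where a linear map on [3d] moments stops being stable.
    The Lyapunov functions replace its spectral analysis by scalar inequalities, each an instance of
    the positive semidefiniteness of the second moments of [(z_i, y_i)]. Two cases escape [L]. If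
    [lam_i = 0] then [s_i = 0], so [L] does not see coordinate [i], whose moments are bounded from
    the summability of [S] instead. If [1 + beta <= eta lam_i] then [s_i] is not a positive weight,
    and a single [W_i] already grows.

    Every iterate is a polynomial in the coordinates of the directions already drawn. Integrability
    is then automatic, and conditioning on the past reduces to independence of monomials in disjoint
    sets of variables.

    Two bases occur: [Q] reduces [P] and [H] simultaneously without commutation but is not
    orthonormal in general, whereas the fourth-moment formula produces the Euclidean norm of [H y],
    which becomes [S] in an orthonormal eigenbasis. *)

Lemma char_poly_conj (F : fieldType) n (Q Q' A : 'M[F]_n) :
  Q' *m Q = 1%:M -> char_poly (Q' *m A *m Q) = char_poly A.
Proof.
move=> QQ; rewrite /char_poly /char_poly_mx.
have -> : 'X%:M - map_mx polyC (Q' *m A *m Q) =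
    map_mx polyC Q' *m ('X%:M - map_mx polyC A) *m map_mx polyC Q.
  rewrite !map_mxM /= mulmxBr mulmxBl; congr (_ - _).
  rewrite mul_mx_scalar -scalemxAl -map_mxM QQ map_mx1.
  by rewrite scalemx1.
rewrite !det_mulmx mulrAC -det_mulmx -map_mxM QQ map_mx1 det1 mul1r //.
Qed.

Lemma char_poly_ublock (F : comNzRingType) n1 n2 (A : 'M[F]_n1) (B : 'M[F]_(n1, n2))
    (D : 'M[F]_n2) :
  char_poly (block_mx A B 0 D) = char_poly A * char_poly D.
Proof.
rewrite /char_poly /char_poly_mx scalar_mx_block map_block_mx opp_block_mx.
by rewrite add_block_mx map_mx0 oppr0 addr0 det_ublock.
Qed.

Lemma dot_col (R : pzRingType) n (v w : 'cV[R]_n) :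
  (v^T *m w) 0 0 = \sum_i v i 0 * w i 0.
Proof. by rewrite mxE; apply: eq_bigr => i _; rewrite mxE. Qed.

Lemma dot_colC (R : comPzRingType) n (v w : 'cV[R]_n) : v^T *m w = w^T *m v.
Proof.
apply/matrixP => i j; rewrite !ord1 !dot_col.
by apply: eq_bigr => k _; rewrite mulrC.
Qed.

Lemma dot_col_ge0 (R : realDomainType) n (v : 'cV[R]_n) : 0 <= (v^T *m v) 0 0.
Proof. by rewrite dot_col sumr_ge0 // => i _; rewrite -expr2 sqr_ge0. Qed.

Lemma dot_col_eq0 (R : realDomainType) n (v : 'cV[R]_n) :
  (v^T *m v) 0 0 = 0 -> v = 0.
Proof.
rewrite dot_col => /eqP; rewrite psumr_eq0; last first.
  by move=> i _; rewrite -expr2 sqr_ge0.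
move=> /allP v0; apply/colP => i; rewrite mxE.
by have /implyP/(_ isT) := v0 i (mem_index_enum i); rewrite mulf_eq0 orbb => /eqP.
Qed.

Lemma dot_col_gt0 (R : realDomainType) n (v : 'cV[R]_n) :
  v != 0 -> 0 < (v^T *m v) 0 0.
Proof.
move=> v0; rewrite lt_neqAle dot_col_ge0 andbT eq_sym.
by apply: contra v0 => /eqP /dot_col_eq0 ->.
Qed.

(** The reflection along [w = v - e_0] exchanges the unit vectors [v] and [e_0]; it degenerates when
    they coincide, hence the separate case. *)
Lemma householder (R : realFieldType) n (v : 'cV[R]_n.+1) :
  (v^T *m v) 0 0 = 1 ->
  exists2 U : 'M[R]_n.+1, U^T *m U = 1%:M & U *m delta_mx 0 0 = v.
Proof.
move=> v1; have [->|ne] := eqVneq v (delta_mx 0 0).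
  by exists 1%:M; rewrite ?trmx1 ?mul1mx.
pose w := v - delta_mx 0 0.
pose s := (w^T *m w) 0 0.
have sn : s != 0.
  by apply/eqP => /dot_col_eq0 /eqP; rewrite subr_eq0 (negbTE ne).
have sE : w^T *m w = s%:M by rewrite [LHS]mx11_scalar.
have we : w^T *m (delta_mx 0 0 : 'cV_n.+1) = (v 0 0 - 1)%:M.
  by rewrite [LHS]mx11_scalar -colE !mxE !eqxx.
(* Both vectors have norm one; this value of [s] makes [U e_0 = e_0 + w]. *)
have sv : s = 2 - 2 * v 0 0.
  have subE (A B C D : 'M[R]_1) : (A - B - (C - D)) 0 0 = A 0 0 - B 0 0 - (C 0 0 - D 0 0).
    by rewrite !mxE.
  rewrite /s /w [_^T]linearB /= mulmxBl !mulmxBr subE v1 trmx_delta -!rowE -colE !mxE !eqxx.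
  by rewrite /=; ring.
have wE : w = v - delta_mx 0 0 by [].
clearbody s w.
exists (1%:M - (2 / s) *: (w *m w^T)).
  rewrite [_^T]linearB /= trmx1 [_^T]linearZ /= trmx_mul trmxK.
  rewrite mulmxBr mulmx1 mulmxBl mul1mx -scalemxAr -scalemxAl.
  rewrite -!mulmxA (mulmxA w^T) sE mul_scalar_mx -!scalemxAr scalerA.
  rewrite scalerA.
  have -> : 2 / s * (2 / s) * s = 2 / s + 2 / s by field.
  by rewrite scalerDl; apply/matrixP => i j; rewrite !mxE; ring.
rewrite mulmxBl mul1mx -scalemxAl -mulmxA we mul_mx_scalar scalerA.
have -> : 2 / s * (v 0 0 - 1) = -1 by rewrite sv; field; move: sn; rewrite sv.
by rewrite scaleN1r opprK wE addrC subrK.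
Qed.

Lemma diag_mx_block1 (R : pzRingType) n (lam : 'I_(1 + n) -> R) :
  diag_mx (\row_i lam i) =
  block_mx (lam (lshift n 0))%:M 0 0 (diag_mx (\row_i lam (rshift 1 i))).
Proof.
apply/matrixP => i j.
case: (split_ordP i) => i' ->; case: (split_ordP j) => j' ->.
- by rewrite block_mxEul !ord1 !mxE !eqxx.
- by rewrite block_mxEur !mxE eq_lrshift.
- by rewrite block_mxEdl !mxE eq_rlshift.
- by rewrite block_mxEdr !mxE eq_rshift.
Qed.

(** Deflation: a unit eigenvector for [lam 0] is moved to [e_0] by [householder], symmetry clears
    the first row along with the first column, and the trailing block keeps the remaining roots. The
    characteristic polynomial is given in split form, so the diagonal comes out in the order of
    [lam]. *)
Lemma sym_diagonalization (R : rcfType) n (A : 'M[R]_n) (lam : 'I_n -> R) :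
  A^T = A -> char_poly A = \prod_(i < n) ('X - (lam i)%:P) ->
  exists2 Q : 'M[R]_n, Q^T *m Q = 1%:M & Q^T *m A *m Q = diag_mx (\row_i lam i).
Proof.
elim: n A lam => [|n IHn] A lam symA chA.
  by exists 1%:M; apply/matrixP => -[].
have : eigenvalue A (lam 0).
  rewrite eigenvalue_root_char chA big_ord_recl rootM root_XsubC eqxx //.
move=> /eigenvalueP[r Ar rn0].
pose l := (r *m r^T) 0 0.
have l0 : 0 < l.
  have : r^T != 0 by apply: contra rn0 => /eqP/(congr1 trmx); rewrite trmxK trmx0 => ->.
  by move/dot_col_gt0; rewrite trmxK.
pose v := (Num.sqrt l)^-1 *: r^T.
have Av : A *m v = lam 0 *: v.
  rewrite /v -scalemxAr -[A in A *m _]symA -trmx_mul Ar [_^T]linearZ /=.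
  by rewrite !scalerA mulrC.
have v1 : (v^T *m v) 0 0 = 1.
  rewrite /v [_^T]linearZ /= trmxK -scalemxAl -scalemxAr scalerA mxE -/l.
  rewrite -invfM -expr2 sqr_sqrtr ?ltW // mulVf // gt_eqF //.
have [U UU Ue] := householder v1.
pose B : 'M[R]_(1 + n) := U^T *m A *m U.
have symB : B^T = B by rewrite /B !trmx_mul trmxK symA mulmxA.
have UU' : U *m U^T = 1%:M by exact: mulmx1C.
have Be : B *m delta_mx 0 0 = lam 0 *: (delta_mx 0 0 : 'cV_n.+1).
  by rewrite /B -!mulmxA Ue Av -Ue -!scalemxAr mulmxA UU mul1mx.
have BD : U^T *m A *m U = B by [].
clearbody B.
have Bc (i j : 'I_(1 + n)) : val j = 0 -> B i j = lam 0 * (val i == 0)%:R.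
  move=> j0; have -> : j = (0 : 'I_n.+1) by exact/val_inj.
  by move/matrixP/(_ i 0): Be; rewrite -colE !mxE !eqxx andbT.
have Bul : ulsubmx B = (lam 0)%:M.
  rewrite [LHS]mx11_scalar !mxE; congr (_%:M).
  by rewrite Bc // eqxx mulr1.
have Bdl : dlsubmx B = 0.
  apply/matrixP => i j; rewrite ord1 !mxE.
  by rewrite Bc // mulr0.
have Bur : ursubmx B = 0.
  by apply: trmx_inj; rewrite trmx_ursub symB Bdl trmx0.
pose A' := drsubmx B.
have BE : B = block_mx (lam 0)%:M 0 0 A'.
  by rewrite -[LHS]submxK Bul Bdl Bur.
have symA' : A'^T = A' by rewrite /A' trmx_drsub symB.
have chA' : char_poly A' = \prod_(i < n) ('X - (lam (lift 0 i))%:P).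
  have : char_poly B = char_poly A by rewrite -BD; apply: char_poly_conj.
  rewrite chA BE char_poly_ublock big_ord_recl.
  have -> : char_poly ((lam 0)%:M : 'M[R]_1) = 'X - (lam 0)%:P.
    by rewrite /char_poly /char_poly_mx det_mx11 !mxE.
  by move/mulfI; apply; rewrite polyXsubC_eq0.
have [Q QQ Qd] := IHn _ _ symA' chA'.
pose V : 'M[R]_(1 + n) := block_mx 1%:M 0 0 Q.
have Vt : V^T = block_mx 1%:M 0 0 Q^T by rewrite /V tr_block_mx trmx1 !trmx0.
have VV : V^T *m V = 1%:M.
  rewrite Vt mulmx_block !mulmx0 !mul0mx !mulmx1 !addr0 add0r QQ.
  by rewrite -scalar_mx_block.
have VBV : V^T *m B *m V = block_mx (lam 0)%:M 0 0 (diag_mx (\row_i lam (lift 0 i))).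
  by rewrite Vt BE !mulmx_block !mulmx0 !mul0mx !mulmx1 !addr0 !add0r mul1mx Qd mul0mx.
exists (U *m V).
  by rewrite trmx_mul -mulmxA (mulmxA U^T) UU mul1mx VV.
have -> : (U *m V)^T *m A *m (U *m V) = V^T *m B *m V.
  by rewrite trmx_mul -BD !mulmxA.
rewrite VBV.
have -> : lam 0 = lam (lshift n 0 : 'I_(1 + n)) by congr lam; exact/val_inj.
have -> : \row_i lam (lift 0 i) = \row_i lam (rshift 1 i : 'I_(1 + n)).
  by apply/rowP => i; rewrite !mxE; congr lam; exact/val_inj.
exact/esym/(@diag_mx_block1 _ n lam).
Qed.

Lemma spd_congr_id (R : rcfType) n (P : 'M[R]_n) :
  P^T = P -> (forall v : 'cV_n, v != 0 -> 0 < (v^T *m P *m v) 0 0) ->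
  exists2 L : 'M[R]_n, L \in unitmx & L^T *m P *m L = 1%:M.
Proof.
elim: n P => [|n IHn]; first by exists 1%:M; [exact: unitmx1|apply/matrixP => -[]].
rewrite -[n.+1]/(1 + n)%N => P symP posP.
pose a : R := P (lshift n 0) (lshift n 0).
pose b : 'cV_n := dlsubmx P.
pose D : 'M[R]_n := drsubmx P.
have PE : P = block_mx a%:M b^T b D :> 'M[R]_(1 + n).
  rewrite -[LHS](@submxK _ 1 n 1 n); congr block_mx.
    by rewrite [LHS]mx11_scalar !mxE.
  by rewrite /b trmx_dlsub symP.
have symD : D^T = D by rewrite /D trmx_drsub symP.
clearbody a b D.
have qE (s : R) (w : 'cV_n) : ((col_mx s%:M w : 'cV_(1 + n))^T *m P *m col_mx s%:M w) 0 0
   = a * s ^+ 2 + 2 * s * (b^T *m w) 0 0 + (w^T *m D *m w) 0 0.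
  rewrite PE tr_col_mx mul_row_block mul_row_col.
  rewrite tr_scalar_mx !mul_scalar_mx !mul_mx_scalar.
  rewrite (dot_colC w) mulmxDl -scalemxAl !mxE eqxx mulr1n; ring.
have a0 : 0 < a.
  have := posP (col_mx 1%:M 0 : 'cV_(1 + n)).
  rewrite qE !mulmx0 !mxE; rewrite expr1n mulr1 mulr0 !addr0; apply.
  apply/eqP => /(congr1 (fun A : 'cV_(1 + n) => A (lshift n 0) 0)).
  by rewrite col_mxEu !mxE => /eqP; rewrite oner_eq0.
(* One Cholesky step: [D'] is the Schur complement of [a]. *)
pose D' := D - a^-1 *: (b *m b^T).
have symD' : D'^T = D'.
  by rewrite /D' [_^T]linearB /= [(_ *: _)^T]linearZ /= trmx_mul trmxK symD.
have posD' (w : 'cV_n) : w != 0 -> 0 < (w^T *m D' *m w) 0 0.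
  (* The first coordinate minimizes the form of [P] for fixed [w]; the minimum is the form of the
     Schur complement. *)
  move=> w0; have := posP (col_mx (- a^-1 * (b^T *m w) 0 0)%:M w : 'cV_(1 + n)).
  have -> : (w^T *m D' *m w) 0 0 = a * (- a^-1 * (b^T *m w) 0 0) ^+ 2 +
      2 * (- a^-1 * (b^T *m w) 0 0) * (b^T *m w) 0 0 + (w^T *m D *m w) 0 0.
    rewrite /D' mulmxBr mulmxBl -scalemxAr -scalemxAl.
    have -> : w^T *m (b *m b^T) *m w = ((b^T *m w) 0 0 ^+ 2)%:M.
      rewrite !mulmxA -mulmxA (dot_colC w); move: (b^T *m w) => c.
      by rewrite [c]mx11_scalar -scalar_mxM !mxE eqxx mulr1n expr2.
    move: (b^T *m w) (w^T *m D *m w) => c e.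
    by rewrite !mxE eqxx mulr1n; field; rewrite gt_eqF.
  rewrite qE; apply.
  apply/eqP => /(congr1 (fun A : 'cV_(1 + n) => dsubmx A)).
  by rewrite col_mxKd => w0'; move: w0; rewrite w0' linear0 eqxx.
have [L Lu LD] := IHn _ symD' posD'.
pose E : 'M[R]_(1 + n) := block_mx (Num.sqrt a)^-1%:M (- a^-1 *: (b^T *m L)) 0 L.
have EtE : E^T = block_mx (Num.sqrt a)^-1%:M 0 (- a^-1 *: (L^T *m b)) L^T.
  by rewrite /E tr_block_mx tr_scalar_mx trmx0 [(_ *: _)^T]linearZ /= trmx_mul trmxK.
have PEE : P *m E = block_mx (a / Num.sqrt a)%:M 0 ((Num.sqrt a)^-1 *: b) (D' *m L).
  rewrite PE /E mulmx_block !mulmx0 !addr0 -scalar_mxM mul_mx_scalar.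
  congr block_mx.
    rewrite -scalemxAr mul_scalar_mx scalerA mulNr mulVf ?gt_eqF //.
    by rewrite scaleN1r addNr.
  by rewrite /D' mulmxBl -scalemxAr -scalemxAl mulmxA scaleNr addrC.
have EPE : E^T *m P *m E = 1%:M.
  rewrite -mulmxA PEE EtE mulmx_block !mulmx0 !mul0mx !addr0 add0r mulmxA LD.
  rewrite -scalar_mxM -scalemxAl mul_mx_scalar -scalemxAr !scalerA.
  have -> : (Num.sqrt a)^-1 * (a / Num.sqrt a) = 1.
    rewrite mulrCA -invfM -expr2 sqr_sqrtr ?ltW // divff // gt_eqF //.
  have -> : - a^-1 * (a / Num.sqrt a) = - (Num.sqrt a)^-1.
    by rewrite mulNr mulKf // gt_eqF.
  by rewrite scaleNr addNr -scalar_mx_block.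
exists E => //.
have : \det (E^T *m P *m E) \is a GRing.unit by rewrite EPE det1 unitr1.
by rewrite det_mulmx unitrM => /andP[].
Qed.

(** [P^-1 = L L^T] makes [P^-1 H] similar to the symmetric [L^T H L], which therefore has the
    eigenvalues [lam]. This is the basis for the mean, where [P] and [H] need not commute. *)
Lemma spd_sym_diagonalization (R : rcfType) n (P H : 'M[R]_n) (lam : 'I_n -> R) :
  P^T = P -> (forall v : 'cV_n, v != 0 -> 0 < (v^T *m P *m v) 0 0) ->
  H^T = H -> char_poly (invmx P *m H) = \prod_(i < n) ('X - (lam i)%:P) ->
  exists2 Q : 'M[R]_n, Q^T *m P *m Q = 1%:M & Q^T *m H *m Q = diag_mx (\row_i lam i).
Proof.
move=> symP posP symH chK.
have [L Lu LP] := spd_congr_id symP posP.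
have Pu : P \in unitmx.
  have : \det (L^T *m P *m L) \is a GRing.unit by rewrite LP det1 unitr1.
  by rewrite !det_mulmx !unitrM => /andP[/andP[]].
have PV : invmx P = L *m L^T.
  have : (L^T *m P) *m L = 1%:M by [].
  by move/mulmx1C; rewrite mulmxA => /(congr1 (mulmx^~ (invmx P))); rewrite mulmxK // mul1mx.
pose A := L^T *m H *m L.
have symA : A^T = A by rewrite /A !trmx_mul trmxK symH mulmxA.
have chA : char_poly A = \prod_(i < n) ('X - (lam i)%:P).
  rewrite -chK PV -[RHS](@char_poly_conj _ _ L (invmx L)) ?mulVmx // /A.
  by rewrite !mulmxA mulVmx // mul1mx.
have [Q QQ Qd] := sym_diagonalization symA chA.
exists (L *m Q).
  by rewrite trmx_mul !mulmxA -(mulmxA _ L^T) -(mulmxA _ (L^T *m P)) LP mulmx1.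
by rewrite trmx_mul -Qd /A !mulmxA.
Qed.

(** * Symmetry of the Hessian *)

Lemma is_derive_line (R : realType) (V : normedModType R) (f : V -> R) (y v : V) (s : R) :
  derivable f (y + s *: v) v ->
  is_derive s 1 (fun s => f (y + s *: v)) ('D_v f (y + s *: v)).
Proof.
move=> df.
have E : (fun h : R => h^-1 *: (f (y + (h *: 1 + s) *: v) - f (y + s *: v))) =
         (fun h : R => h^-1 *: (f (h *: v + (y + s *: v)) - f (y + s *: v))).
  apply/funext => h; congr (_ *: (f _ - _)).
  by rewrite scalerDl scaler1 addrCA.
split; first by rewrite /derivable /= E.
by rewrite /derive /= E.
Qed.


Lemma nbhs_norm_ex (R : realType) (V : normedModType R) (x : V) (A : V -> Prop) :
  (\forall y \near x, A y) -> exists2 r : R, 0 < r & forall v, `|v| < r -> A (x + v).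
Proof.
move=> /nbhs_ballP[r /= r0 rA]; exists r => // v vr; apply: rA.
by rewrite -ball_normE /= opprD addrA subrr add0r normrN.
Qed.

Lemma differentiable_eps (R : realType) (V : normedModType R) (f : V -> R) (x : V) (e : R) :
  differentiable f x -> 0 < e -> exists2 r : R, 0 < r &
    forall v, `|v| < r -> `|f (x + v) - f x - 'd f x v| <= e * `|v|.
Proof.
move=> df e0.
have /eqaddoP /(_ e e0) /nbhs_norm_ex[r r0 rH] := diff_locally df.
exists r => // v /rH; rewrite add0r => H; apply: le_trans H.
by rewrite !fctE /= opprD addrA [v + x]addrC.
Qed.

Definition second_diff (R : realType) (V : normedModType R) (f : V -> R) (x a b : V) : R :=
  f (x + a + b) - f (x + a) - f (x + b) + f x.

(** No continuity of second derivatives is involved: the mean value theorem turns the second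
    difference into a difference of two values of [partial f i], and differentiability of
    [partial f i] at [x] expands both. *)
Lemma second_diff_eps (R : realType) d (f : 'cV[R]_d -> R) (x : 'cV[R]_d) i j (e : R) :
  twice_diff_near f x -> 0 < e -> exists2 r : R, 0 < r & forall h, 0 < h < r ->
   `|second_diff f x (h *: basis_vec R i) (h *: basis_vec R j) - h ^+ 2 * hessian f x i j|
     <= e * h ^+ 2.
Proof.
move=> tw e0; set a := basis_vec R i; set b := basis_vec R j.
pose B := `|a| + `|b| + 1.
have aB : `|a| <= B by rewrite /B -addrA lerDl addr_ge0.
have B0 : 0 < B by rewrite /B ltr_wpDl // addr_ge0.
have dpi : differentiable (partial f i) x by exact: (nbhs_singleton tw).2.
have [r1 r10 H1] := nbhs_norm_ex tw.
(* Each of the two expansions errs by at most [e / (2 * B)] times a displacement of norm at most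
   [h * B], that is [e * h / 2]. *)
have [|r2 r20 H2] := @differentiable_eps _ _ _ _ (e / (2 * B)) dpi.
  by rewrite divr_gt0 // mulr_gt0.
exists (Num.min r1 r2 / B); first by rewrite divr_gt0 // lt_min r10.
move=> h /andP[h0]; rewrite ltr_pdivlMr // lt_min => /andP[hr1 hr2].
have small (c t : R) : 0 <= c <= h -> 0 <= t <= h -> `|c *: a + t *: b| <= h * B.
  move=> /andP[c0 ch] /andP[t0 th].
  apply: le_trans (ler_normD _ _) _; rewrite !normrZ !ger0_norm //.
  have n1 := normr_ge0 a; have n2 := normr_ge0 b.
  have := ler_wpM2r n1 ch; have := ler_wpM2r n2 th; rewrite /B.
  by rewrite !mulrDr; lra.
pose g (s : R) := f (x + h *: b + s *: a) - f (x + s *: a).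
pose dg (s : R) := partial f i (x + h *: b + s *: a) - partial f i (x + s *: a).
have dline (t s : R) : 0 <= t <= h -> 0 <= s <= h ->
    is_derive s 1 (fun s => f (x + t *: b + s *: a)) (partial f i (x + t *: b + s *: a)).
  move=> th sh; apply: is_derive_line; apply: diff_derivable.
  rewrite -addrA [t *: b + _]addrC; apply: (H1 _ _).1.
  by apply: le_lt_trans (small _ _ sh th) _.
have gder s : 0 <= s <= h -> is_derive s 1 g (dg s).
  move=> sh; apply: is_deriveB; first by apply: dline => //; rewrite ltW //= lexx.
  have := @dline 0 s; rewrite scale0r addr0; apply => //.
  by rewrite lexx ltW.
have [||c] := @MVT _ g dg 0 h h0.
- by move=> s; rewrite in_itv /= => /andP[s0 sh]; apply: gder; rewrite !ltW.
- apply: derivable_within_continuous => s; rewrite in_itv /= => sh.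
  by apply: ex_derive; exact: gder.
rewrite in_itv /= subr0 => /andP[c0 ch] gE.
have ch' : 0 <= c <= h by rewrite !ltW.
have hh : 0 <= h <= h by rewrite lexx ltW.
have zh : 0 <= (0 : R) <= h by rewrite lexx ltW.
have -> : second_diff f x (h *: a) (h *: b) = dg c * h.
  rewrite -gE /g /second_diff !scale0r !addr0 [x + h *: b + _]addrAC opprB; ring.
have -> : hessian f x i j = 'd (partial f i) x b by rewrite mxE deriveE.
have E1 := H2 (c *: a + h *: b) (le_lt_trans (small _ _ ch' hh) hr2).
have E2 := H2 (c *: a + 0 *: b) (le_lt_trans (small _ _ ch' zh) hr2).
have K1 := small _ _ ch' hh; have K2 := small _ _ ch' zh.
have eB : 0 <= e / (2 * B) by rewrite divr_ge0 ?ltW // mulr_gt0.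
have F1 := le_trans E1 (ler_wpM2l eB K1).
have F2 := le_trans E2 (ler_wpM2l eB K2).
have dD : 'd (partial f i) x (c *: a + h *: b) =
    c * 'd (partial f i) x a + h * 'd (partial f i) x b by rewrite linearD !linearZ.
have dZ : 'd (partial f i) x (c *: a) = c * 'd (partial f i) x a by rewrite linearZ.
move: F1 F2; rewrite scale0r addr0 dD dZ.
have -> : e / (2 * B) * (h * B) = e * h / 2 by field; rewrite gt_eqF.
rewrite [x + (c *: a + _)]addrA [x + c *: a + h *: b]addrAC => F1 F2.
have -> : dg c * h - h ^+ 2 * 'd (partial f i) x b =
  h * ((partial f i (x + h *: b + c *: a) - partial f i x
     - (c * 'd (partial f i) x a + h * 'd (partial f i) x b))
   - (partial f i (x + c *: a) - partial f i x - c * 'd (partial f i) x a)).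
  rewrite /dg; ring.
rewrite normrM gtr0_norm // expr2 mulrCA ler_pM2l //.
apply: le_trans (ler_normB _ _) _; rewrite [e * h](splitr _); exact: (lerD F1 F2).
Qed.

(** The second difference does not change when its increments are exchanged, so after division by
    [h ^+ 2] it approximates both mixed entries. *)
Lemma hessian_sym (R : realType) d (f : 'cV[R]_d -> R) (x : 'cV[R]_d) :
  twice_diff_near f x -> trmx (hessian f x) = hessian f x.
Proof.
move=> tw; apply/matrixP => i j; rewrite [LHS]mxE.
apply/eqP; rewrite -subr_eq0 -normr_le0; apply/ler_addgt0Pl => e e0; rewrite addr0.
have e2 : 0 < e / 2 by rewrite divr_gt0.
have [r1 r10 H1] := second_diff_eps i j tw e2.
have [r2 r20 H2] := second_diff_eps j i tw e2.
pose h := Num.min r1 r2 / 2.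
have m0 : 0 < Num.min r1 r2 by rewrite lt_min r10.
have h0 : 0 < h by rewrite divr_gt0.
have hm : h < Num.min r1 r2 by rewrite /h; lra.
have /andP[hr1 hr2] : (h < r1) && (h < r2) by move: hm; rewrite lt_min.
have A1 := H1 h; have A2 := H2 h.
rewrite h0 hr1 in A1; rewrite h0 hr2 in A2.
move: (A1 isT) (A2 isT).
have -> : second_diff f x (h *: basis_vec R j) (h *: basis_vec R i) =
   second_diff f x (h *: basis_vec R i) (h *: basis_vec R j).
  by rewrite /second_diff [x + _ + h *: basis_vec R i]addrAC; ring.
move: (second_diff _ _ _ _) => D {A1 A2}A1 A2.
have h20 : 0 < h ^+ 2 by rewrite exprn_gt0.
rewrite -(ler_pM2l h20) -{1}[h ^+ 2]gtr0_norm // -normrM.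
have -> : h ^+ 2 * (hessian f x j i - hessian f x i j) =
   (D - h ^+ 2 * hessian f x i j) - (D - h ^+ 2 * hessian f x j i) by ring.
apply: le_trans (ler_normB _ _) _.
by apply: le_trans (lerD A1 A2) _; rewrite -mulrDl -splitr mulrC.
Qed.

(** * Products of independent normal variables *)

Section transfer.
Import HBNNSimple.
Local Open Scope ereal_scope.

(* With [X := id] this is integration against a density; with [g] a product of functions
   of variables independent of [X] it is the factorization of expectations. *)
Lemma ge0_integral_transfer (d1 d2 : measure_display) (T : measurableType d1)
    (Y : measurableType d2) (R : realType) (mu : {measure set T -> \bar R})
    (nu : {measure set Y -> \bar R}) (X : T -> Y) (g : T -> R) (c : R) (f : Y -> \bar R) :
  measurable_fun setT X -> measurable_fun setT g -> (forall x, (0 <= g x)%R) -> (0 <= c)%R ->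
  (forall B, measurable B -> \int[mu]_x (g x * \1_B (X x))%:E = c%:E * nu B) ->
  (forall y, 0 <= f y) -> measurable_fun setT f ->
  \int[mu]_x ((g x)%:E * f (X x)) = c%:E * \int[nu]_y f y.
Proof.
move=> mX mg g0 c0 gB f0 mf.
pose h := nnsfun_approx measurableT mf.
have hf y : (EFin \o h n) y @[n --> \oo] --> f y by exact: cvg_nnsfun_approx.
have hnd y : {homo (fun n => h n y) : n m / (n <= m)%N >-> (n <= m)%R}.
  by move=> n m nm; exact/lefP/nd_nnsfun_approx.
have mh n : measurable_fun setT (EFin \o h n) by exact/measurable_EFinP.
have mhX n : measurable_fun setT (fun x => (h n (X x))%:E).
  by apply/measurable_EFinP; apply: measurableT_comp.
have mgE : measurable_fun setT (EFin \o g) by exact/measurable_EFinP.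
have H1 : c%:E * (\int[nu]_y (EFin \o h n) y) @[n --> \oo] --> c%:E * \int[nu]_y f y.
  apply: cvgeZl => //.
  have -> : \int[nu]_y f y = \int[nu]_y limn (fun n => (EFin \o h n) y).
    by apply: eq_integral => y _; apply/esym/cvg_lim.
  apply: cvg_monotone_convergence => //.
  - by move=> n y _; rewrite lee_fin.
  - by move=> y _ n m nm; rewrite lee_fin hnd.
have H2 : \int[mu]_x ((g x)%:E * (h n (X x))%:E) @[n --> \oo]
    --> \int[mu]_x ((g x)%:E * f (X x)).
  have -> : \int[mu]_x ((g x)%:E * f (X x)) =
     \int[mu]_x limn (fun n => (g x)%:E * (h n (X x))%:E).
    by apply: eq_integral => x _; apply/esym/cvg_lim => //; apply: cvgeZl => //; exact: hf.
  apply: (@cvg_monotone_convergence _ _ _ mu setT measurableT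
    (fun n x => (g x)%:E * (h n (X x))%:E)) => //.
  - by move=> n; apply: emeasurable_funM.
  - by move=> n x _; rewrite mule_ge0 ?lee_fin.
  - by move=> x _ n m nm; rewrite lee_wpmul2l ?lee_fin // hnd.
have simple n : \int[mu]_x ((g x)%:E * (h n (X x))%:E) = c%:E * \int[nu]_y (EFin \o h n) y.
  have mhr r : measurable (h n @^-1` [set r]) by [].
  transitivity (\int[mu]_x (\sum_(r \in range (h n))
      (r * (g x * \1_(h n @^-1` [set r]) (X x)))%:E)).
    apply: eq_integral => x _; rewrite -EFinM [in LHS]fimfunE fsumEFin //.
    by congr EFin; rewrite mulr_fsumr //; apply: eq_fsbigr => r _; rewrite mulrCA.
  rewrite ge0_integral_fsum //; last 2 first.
  - move=> r; apply/measurable_EFinP; apply: measurable_funM => //.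
    apply: measurable_funM => //; apply: measurableT_comp => //.
  - move=> r x _; rewrite lee_fin mulrCA mulr_ge0 //.
    by have := nnfun_muleindic_ge0 (h n) r (X x); rewrite lee_fin.
  rewrite [X in c%:E * X](_ : _ = \sum_(r \in range (h n)) r%:E * nu (h n @^-1` [set r])).
    rewrite ge0_mule_fsumr; last first.
      move=> r; have [r0|r0] := leP 0%R r; first by rewrite mule_ge0 // lee_fin.
      by rewrite preimage_nnfun0 // measure0 mule0.
    apply: eq_fsbigr => r /[!inE] -[y _ <-].
    under eq_integral do rewrite EFinM.
    rewrite ge0_integralZl //.
    - by rewrite gB // muleCA.
    - apply/measurable_EFinP; apply: measurable_funM => //.
      by apply: measurableT_comp.
    - by move=> x _; rewrite lee_fin mulr_ge0.
    - by rewrite lee_fin.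
  under eq_integral do rewrite /= fimfunE -fsumEFin //.
  rewrite ge0_integral_fsum //; last 2 first.
  - by move=> r; exact/measurable_EFinP/measurable_funM.
  - by move=> r y _; exact: nnfun_muleindic_ge0.
  apply: eq_fsbigr => r _.
  by under eq_integral do rewrite EFinM; rewrite integralZl_indic_nnsfun // integral_indic // setIT.
have E : (fun n => \int[mu]_x ((g x)%:E * (h n (X x))%:E)) =
    (fun n => c%:E * \int[nu]_y (EFin \o h n) y) by apply/funext.
by move: H2; rewrite E => H2; exact: (cvg_unique _ H2 H1).
Qed.
End transfer.

Section independence.
Context {dT : measure_display} {T : measurableType dT} {R : realType} {I : eqType}.
Variables (P : probability T R) (X : I -> T -> R).
Hypothesis mX : forall i, measurable_fun setT (X i).
Hypothesis indX : mutually_independent P X.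
Hypothesis normX : forall i, std_normal P (X i).

Let N : probability (measurableTypeR R) R := normal_prob 0 1.

Lemma measurable_prod_comp (J : seq I) (p : pred I) (f : I -> R -> R) :
  (forall j, measurable_fun setT (f j)) ->
  measurable_fun setT (fun w => \prod_(j <- J | p j) f j (X j w)).
Proof.
move=> mf; elim: J => [|j J IH].
  by under eq_fun do rewrite big_nil; exact: measurable_cst.
under eq_fun do rewrite big_cons; case: (p j) => //.
by apply: measurable_funM => //; apply: measurableT_comp.
Qed.

(* Independence is known for indicators ([J1 = [::]]); the indicators are replaced by
   arbitrary nonnegative functions one index of [J1] at a time. *)
Lemma ge0_indep_prod (J J1 : seq I) (f : I -> R -> R) (M : I -> R) : uniq J ->
  (forall j, measurable_fun setT (f j)) -> (forall j x, 0 <= f j x) ->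
  (forall j, \int[N]_x (f j x)%:E = (M j)%:E)%E ->
  (forall j, j \in J -> j \notin J1 -> exists2 B, measurable B & f j = \1_B) ->
  (\int[P]_w (\prod_(j <- J) f j (X j w))%:E = (\prod_(j <- J) M j)%:E)%E.
Proof.
move=> uJ; elim: J1 f M => [|j J1 IH] f M mf f0 fM fB.
  (* Outside [J] the choice is [setT], because [indX] asks for a measurable [B j] at every index. *)
  have /choice[B BP] : forall j, exists B : set R,
      measurable B /\ (j \in J -> f j = \1_B).
    move=> j; have [jJ|jJ] := boolP (j \in J); last by exists setT; split.
    by have [B mB fjE] := fB j jJ isT; exists B.
  have E w : \prod_(j <- J) f j (X j w) =
      \1_(\bigcap_(j in [set` J]) (X j @^-1` B j)) w :> R.
    rewrite (eq_big_seq (fun j => \1_(B j) (X j w))); last by move=> j /(BP j).2 ->.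
    elim: J {uJ fB BP} => [|j J IHJ].
      by rewrite big_nil set_nil bigcap_set0 indicT.
    have -> : [set` j :: J] = j |` [set` J].
      apply/seteqP; split=> k /=; rewrite inE.
        by case/orP => [/eqP|]; [left|right].
      by case=> [->|->]; rewrite ?eqxx ?orbT.
    rewrite big_cons IHJ bigcap_setU1 indicI /=.
    by congr (_ * _); rewrite !indicE; congr (nat_of_bool _)%:R; apply/idP/idP; rewrite !inE.
  under eq_integral do rewrite E.
  rewrite integral_indic //; last first.
    apply: fin_bigcap_measurable => // j _.
    by rewrite -[_ @^-1` _]setTI; apply: mX => //; exact: (BP j).1.
  rewrite setIT; apply: (etrans (indX uJ (fun j => (BP j).1))).
  rewrite (big_morph EFin EFinM erefl); apply: eq_big_seq => j jJ.
  rewrite normX; last exact: (BP j).1.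
  by rewrite -fM (BP j).2 // integral_indic ?setIT //; exact: (BP j).1.
have [jJ|jJ] := boolP (j \in J); last first.
  apply: IH => // k kJ kJ1; apply: fB => //; rewrite inE negb_or kJ1 andbT.
  by apply: contra jJ => /eqP <-.
pose g w := \prod_(k <- J | k != j) f k (X k w).
pose c := \prod_(k <- J | k != j) M k.
rewrite (bigD1_seq j) //= -/c mulrC EFinM -fM.
under eq_integral do rewrite (bigD1_seq j) //= mulrC EFinM -/(g _).
have M0 k : 0 <= M k.
  by rewrite -lee_fin -fM; apply: integral_ge0 => x _; rewrite lee_fin.
apply: (@ge0_integral_transfer _ _ _ _ _ P N (X j) g c (fun x => (f j x)%:E)) => //.
- exact: mX.
- exact: measurable_prod_comp.
- by move=> w; apply: prodr_ge0.
- by apply: prodr_ge0.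
- move=> B mB.
  (* The measure sending [B] to the expectation of [g] times the indicator of [X j] in [B] is given
     by the induction hypothesis, with [f j] replaced by that indicator. *)
  pose f' k := if k == j then \1_B else f k.
  pose M' k := if k == j then fine (N B) else M k.
  have := IH f' M'.
  rewrite (bigD1_seq j) //= /M' eqxx EFinM fineK ?fin_num_measure //.
  under eq_bigr => k /negbTE kj do rewrite kj.
  rewrite -/c muleC => <-.
  + apply: eq_integral => w _; rewrite (bigD1_seq j) //= /f' eqxx mulrC.
    by under [in RHS]eq_bigr => k /negbTE kj do rewrite kj.
  + by move=> k; rewrite /f'; case: eqP => // _; exact: measurable_indic.
  + by move=> k x; rewrite /f'; case: eqP => // _; rewrite indicE.
  + move=> k; rewrite /f'; case: eqP => // _.
    by rewrite integral_indic // setIT fineK // fin_num_measure.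
  + move=> k kJ kJ1; rewrite /f'; case: eqP => [_|/eqP kj]; first by exists B.
    by apply: fB; rewrite // inE negb_or kj.
- by move=> y; rewrite lee_fin.
- by apply/measurable_EFinP; exact: mf.
Qed.

Lemma indep_prod_integrable (J : seq I) (f : I -> R -> R) : uniq J ->
  (forall j, N.-integrable setT (EFin \o f j)) ->
  P.-integrable setT (fun w => (\prod_(j <- J) f j (X j w))%:E).
Proof.
move=> uJ fN.
have mf j : measurable_fun setT (f j).
  by have /integrableP[/measurable_EFinP] := fN j.
apply/integrableP; split.
  by apply/measurable_EFinP; exact: measurable_prod_comp.
under eq_integral do rewrite abse_EFin normr_prod.
rewrite (@ge0_indep_prod J J (fun j x => `|f j x|)
  (fun j => fine (\int[N]_x (`|f j x|)%:E)%E)) ?ltry //.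
- by move=> j; apply: measurableT_comp.
- move=> j; rewrite fineK // ge0_fin_numE; last by apply: integral_ge0.
  by have /integrableP[_] := fN j.
- by move=> j ->.
Qed.

Lemma indep_prod (J : seq I) (f : I -> R -> R) : uniq J ->
  (forall j, N.-integrable setT (EFin \o f j)) ->
  (\int[P]_w (\prod_(j <- J) f j (X j w))%:E =
    (\prod_(j <- J) fine (\int[N]_x (f j x)%:E)%E)%:E)%E.
Proof.
move=> uJ.
(* [J1] collects the indices whose function may change sign. *)
suff main (J1 : seq I) : (forall j, N.-integrable setT (EFin \o f j)) ->
    (forall j, j \in J -> j \notin J1 -> forall x, 0 <= f j x) ->
    (\int[P]_w (\prod_(j <- J) f j (X j w))%:E =
      (\prod_(j <- J) fine (\int[N]_x (f j x)%:E)%E)%:E)%E.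
  by move=> fN; apply: (main J) => // j ->.
elim: J1 f => [|j J1 IH] f fN f0.
  have E k x : k \in J -> f k x = `|f k x|.
    by move=> kJ; rewrite ger0_norm // f0.
  under eq_integral do under eq_big_seq => k kJ do rewrite (E _ _ kJ).
  rewrite (@ge0_indep_prod J J (fun j x => `|f j x|)
    (fun j => fine (\int[N]_x (`|f j x|)%:E)%E)) //.
  - congr EFin; apply: eq_big_seq => k kJ; congr fine.
    by apply: eq_integral => x _; rewrite -E.
  - move=> k; apply: measurableT_comp => //.
    by have /integrableP[/measurable_EFinP] := fN k.
  - move=> k; rewrite fineK // ge0_fin_numE; last by apply: integral_ge0.
    by have /integrableP[_] := fN k.
  - by move=> k ->.
have [jJ|jJ] := boolP (j \in J); last first.
  apply: IH => // k kJ kJ1; apply: f0 => //; rewrite inE negb_or kJ1 andbT.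
  by apply: contra jJ => /eqP <-.
(* Positive and negative parts of [f j]: both are nonnegative, so [j] leaves the list of indices of
   unknown sign. *)
pose fp k := if k == j then (fun x => 2^-1 * (`|f k x| + f k x)) else f k.
pose fm k := if k == j then (fun x => 2^-1 * (`|f k x| - f k x)) else f k.
have mf k : measurable_fun setT (f k).
  by have /integrableP[/measurable_EFinP] := fN k.
have mnf k : measurable_fun setT (fun x => `|f k x|) by exact: measurableT_comp.
have fpN k : N.-integrable setT (EFin \o fp k).
  rewrite /fp; case: eqP => // _.
  apply: (le_integrable measurableT _ _ (fN k)).
    apply/measurable_EFinP.
    exact: (measurable_funM (measurable_cst _) (measurable_funD (mnf k) (mf k))).
  move=> x _; rewrite !abse_EFin lee_fin normrM [ `|2^-1|]ger0_norm //.
  by apply: le_trans (ler_wpM2l _ (ler_normD _ _)) _; rewrite // normr_id; lra.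
have fmN k : N.-integrable setT (EFin \o fm k).
  rewrite /fm; case: eqP => // _.
  apply: (le_integrable measurableT _ _ (fN k)).
    apply/measurable_EFinP.
    exact: (measurable_funM (measurable_cst _) (measurable_funB (mnf k) (mf k))).
  move=> x _; rewrite !abse_EFin lee_fin normrM [ `|2^-1|]ger0_norm //.
  by apply: le_trans (ler_wpM2l _ (ler_normB _ _)) _; rewrite // normr_id; lra.
have fE x : f j x = fp j x - fm j x by rewrite /fp /fm eqxx; field.
have fpJ k : k != j -> fp k = f k by move/negbTE; rewrite /fp => ->.
have fmJ k : k != j -> fm k = f k by move/negbTE; rewrite /fm => ->.
have HP := IH fp fpN; have HM := IH fm fmN.
have -> : (\int[P]_w (\prod_(k <- J) f k (X k w))%:E =
   \int[P]_w ((\prod_(k <- J) fp k (X k w))%:E - (\prod_(k <- J) fm k (X k w))%:E))%E.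
  apply: eq_integral => w _; rewrite -EFinB; congr EFin.
  rewrite !(bigD1_seq j) //= fE mulrBl; congr (_ * _ - _ * _).
    by apply: eq_bigr => k /fpJ ->.
  by apply: eq_bigr => k /fmJ ->.
rewrite integralB //; try exact: indep_prod_integrable.
rewrite HP ?HM; last 2 first.
- move=> k kJ kJ1 x; rewrite /fm; case: eqP => [_|/eqP kj].
    by rewrite mulr_ge0 // subr_ge0 ler_norm.
  by apply: f0; rewrite // inE negb_or kj.
- move=> k kJ kJ1 x; rewrite /fp; case: eqP => [_|/eqP kj].
    by rewrite mulr_ge0 // -lerBlDr sub0r -normrN ler_norm.
  by apply: f0; rewrite // inE negb_or kj.
rewrite -EFinB; congr EFin; rewrite !(bigD1_seq j) //=.
under eq_bigr => k /fpJ -> do over.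
under [X in _ - _ * X]eq_bigr => k /fmJ -> do over.
rewrite -mulrBl; congr (_ * _).
have IB : (\int[N]_x (f j x)%:E = \int[N]_x (fp j x)%:E - \int[N]_x (fm j x)%:E)%E.
  rewrite -(integralB measurableT (fpN j) (fmN j)).
  by apply: eq_integral => x _; rewrite fE EFinB.
have finP := integrable_fin_num measurableT (fpN j).
have finM := integrable_fin_num measurableT (fmN j).
by have := congr1 fine IB; rewrite (fineB finP finM) => ->.
Qed.

End independence.

(** * Moments of the standard normal law *)

Section gaussian.
Variable R : realType.

Definition gphi (x : R) : R := normal_peak 1 * expR (- (2^-1 * x ^+ 2)).

Lemma normal_pdf01 : normal_pdf (0 : R) 1 = gphi.
Proof.
rewrite normal_pdfE ?oner_neq0 //; apply/funext => x; rewrite /gphi /normal_fun.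
by congr (_ * expR _); rewrite subr0 expr1n mulNr mulrC.
Qed.

Lemma gphi_ge0 x : 0 <= gphi x.
Proof. by rewrite -normal_pdf01 normal_pdf_ge0. Qed.

(* An integrable majorant that absorbs every polynomial factor of the density. *)
Definition gmaj (x : R) : R := expR (- (4^-1 * x ^+ 2)).

(** Raise [y / (k + 1) <= expR (y / (k + 1))] to the power [k + 1]. *)
Lemma expR_ge_pow (k : nat) (y : R) : 0 <= y -> y ^+ k.+1 <= k.+1%:R ^+ k.+1 * expR y.
Proof.
move=> y0.
have k0 : (0 : R) < k.+1%:R by rewrite ltr0n.
have -> : expR y = expR (y / k.+1%:R) ^+ k.+1.
  by rewrite -expRM_natl; congr expR; field; rewrite addrC natr1 gt_eqF.
rewrite -exprMn lerXn2r ?nnegrE // ?mulr_ge0 ?expR_ge0 // ?ltW //.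
have := expR_ge1Dx (y / k.+1%:R).
rewrite -(ler_pM2l k0) mulrDr mulrCA divff ?gt_eqF // !mulr1 => H.
by apply: lt_le_trans H; rewrite ltrDr.
Qed.

Lemma pow_gphi_le (j : nat) : exists2 C : R, 0 <= C & forall x, `|x ^+ j * gphi x| <= C * gmaj x.
Proof.
(* From [|x|^j <= 1 + (x^2)^(j+1)] and [expR_ge_pow] at [x^2 / 4]. The density is a constant times
   [gmaj^2], and one factor absorbs the power. *)
pose D : R := 1 + (4 * j.+1%:R) ^+ j.+1.
have D0 : 0 <= D by rewrite addr_ge0 // exprn_ge0 // mulr_ge0.
exists (normal_peak 1 * D); first by rewrite mulr_ge0 // normal_peak_ge0.
move=> x; rewrite normrM normrX [ `|gphi x|]ger0_norm ?gphi_ge0 // /gphi mulrCA -mulrA.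
apply: ler_wpM2l; first exact: normal_peak_ge0.
have -> : expR (- (2^-1 * x ^+ 2)) = gmaj x * gmaj x.
  by rewrite /gmaj -expRD; congr expR; field.
rewrite mulrA; apply: ler_wpM2r; first exact: expR_ge0.
have E1 : 1 <= expR (4^-1 * x ^+ 2).
  by rewrite -[leLHS]expR0 ler_expR mulr_ge0 // sqr_ge0.
rewrite /gmaj expRN -ler_pdivlMr ?invr_gt0 ?expR_gt0 // invrK.
have : `|x| ^+ j <= 1 + (x ^+ 2) ^+ j.+1.
  have [x1|x1] := leP `|x| 1.
    by apply: (@le_trans _ _ 1); [exact: exprn_ile1|rewrite lerDl exprn_ge0 // sqr_ge0].
  rewrite -[x ^+ 2]real_normK ?num_real // -exprM.
  apply: (@le_trans _ _ (`|x| ^+ (2 * j.+1))); last by rewrite lerDr.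
  rewrite ler_eXn2l //; lia.
move=> H; apply: le_trans H _; rewrite /D mulrDl mul1r lerD //.
have := @expR_ge_pow j (4^-1 * x ^+ 2).
rewrite mulr_ge0 ?sqr_ge0 // => /(_ isT).
rewrite !exprMn => H; rewrite -mulrA.
apply: le_trans (ler_wpM2l _ H); last by rewrite exprn_ge0.
by rewrite exprVn mulVKf // expf_neq0.
Qed.

Notation mu := (@lebesgue_measure R).

(** Up to a constant, [gmaj] is the normal density of variance 2. *)
Lemma integrable_gmaj : mu.-integrable setT (EFin \o gmaj).
Proof.
have s2 : Num.sqrt 2 != 0 :> R by rewrite gt_eqF // sqrtr_gt0.
have -> : EFin \o gmaj =
    (fun x => (normal_peak (Num.sqrt 2))^-1%:E * (normal_pdf 0 (Num.sqrt 2) x)%:E)%E.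
  apply/funext => x; rewrite /= normal_pdfE // -EFinM; congr EFin.
  rewrite mulKf ?gt_eqF ?normal_peak_gt0 // /gmaj /normal_fun subr0 sqr_sqrtr //.
  by congr expR; field.
by apply: integrableZl => //; exact: integrable_normal_pdf.
Qed.

Lemma continuous_pow_gphi (j : nat) : continuous (fun x : R => x ^+ j * gphi x).
Proof.
rewrite -normal_pdf01 => x; apply: cvgM; first exact: exprn_continuous.
exact: (@continuous_normal_pdf R 0 1 (oner_neq0 _) x).
Qed.

Lemma integrable_pow_gphi (j : nat) : mu.-integrable setT (fun x => (x ^+ j * gphi x)%:E).
Proof.
have [C C0 HC] := pow_gphi_le j.
apply: (@le_integrable _ _ _ mu setT measurableT _ (fun x => (C%:E * (gmaj x)%:E)%E)).
- by apply/measurable_EFinP; apply: continuous_measurable_fun; exact: continuous_pow_gphi.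
- move=> x _; rewrite -EFinM !abse_EFin lee_fin.
  by apply: le_trans (HC x) _; rewrite ler_norm.
- by apply: integrableZl => //; exact: integrable_gmaj.
Qed.

(** Prepares Gaussian integration by parts. At [j = 0] the truncated [j.-1] is harmless, since it is
    multiplied by [0]. *)
Lemma is_derive_pow_gphi (j : nat) (x : R) :
  is_derive x 1 (fun x : R => x ^+ j * gphi x) ((j%:R * x ^+ j.-1 - x ^+ j.+1) * gphi x).
Proof.
have dq : is_derive x 1 (fun x : R => - (2^-1 * x ^+ 2)) (- x).
  by apply: is_derive_eq; rewrite /GRing.scale /=; field.
have dg : is_derive x 1 gphi (- x * gphi x).
  rewrite /gphi.
  have de := @is_derive1_comp R expR _ x _ _ (is_derive_expR _) dq.
  have := @is_deriveM R _ (cst (normal_peak 1)) _ x 1 _ _ (is_derive_cst _ _ _) de.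
  move=> H; have -> : - x * (normal_peak 1 * expR (- (2^-1 * x ^+ 2))) =
      cst (normal_peak 1) x *: (expR (- (2^-1 * x ^+ 2)) * - x) +
     (expR \o (fun x0 : R => - (2^-1 * x0 ^+ 2))) x *: 0.
    by rewrite /GRing.scale /=; ring.
  exact: H.
have dp : is_derive x 1 (fun x : R => x ^+ j) (j%:R * x ^+ j.-1).
  by split; [exact: exprn_derivable|rewrite exp_derive /GRing.scale /= mulr1].
have H := @is_deriveM R _ (fun x : R => x ^+ j) gphi x 1 _ _ dp dg.
have -> : (j%:R * x ^+ j.-1 - x ^+ j.+1) * gphi x =
    x ^+ j *: (- x * gphi x) + gphi x *: (j%:R * x ^+ j.-1).
  by rewrite /GRing.scale /= exprS; ring.
exact: H.
Qed.

(** The harmonic sequence serves as a known null sequence: [expR (n^2 / 4) >= 1 + n^2 / 4 >= (n + 1)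
    / 2] by [(n - 1)^2 >= 0]. *)
Lemma gmaj_le_harmonic (n : nat) (x : R) : `|x| = n%:R -> gmaj x <= 2 * harmonic n.
Proof.
move=> xn; rewrite /gmaj expRN.
have -> : 2 * harmonic n = (2^-1 * n.+1%:R : R)^-1 by rewrite invfM invrK.
rewrite lef_pV2 ?posrE ?expR_gt0 ?mulr_gt0 //.
apply: le_trans (expR_ge1Dx _).
rewrite -[x ^+ 2]real_normK ?num_real // xn -[n.+1%:R]natr1.
have := sqr_ge0 (n%:R - 1 : R); rewrite sqrrB1; lra.
Qed.

Lemma cvg_itv_integral (G : R -> R) : mu.-integrable setT (EFin \o G) ->
  (\int[mu]_(x in `[(- n%:R)%R, n%:R%R]) (G x)%:E)%E @[n --> \oo] --> (\int[mu]_x (G x)%:E)%E.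
Proof.
move=> iG.
have mG : measurable_fun setT (EFin \o G) by have /integrableP[] := iG.
pose G_ (n : nat) (x : R) := ((G x)%:E * (\1_(`[- n%:R, n%:R]%classic : set R) x)%:E)%E.
have E n : (\int[mu]_(x in `[(- n%:R)%R, n%:R%R]) (G x)%:E = \int[mu]_x G_ n x)%E.
  rewrite integral_mkcond; apply: eq_integral => x _.
  by rewrite epatch_indic.
under eq_fun do rewrite E.
have [] := @dominated_convergence _ _ _ mu setT measurableT G_ (EFin \o G)
  (fun x => `|(G x)%:E|%E) => //.
- move=> n; apply: emeasurable_funM => //.
  by apply/measurable_EFinP; exact: measurable_indic.
- apply: aeW => x _; apply: cvg_near_cst; near=> n.
  rewrite /G_ indicE mem_set ?mule1 //= in_itv /=.
  have : `|x| <= n%:R by near: n; exact: nbhs_infty_ger.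
  by rewrite ler_norml.
- exact: integrable_abse.
- apply: aeW => x n _; rewrite /G_ abseM.
  rewrite -[leRHS]mule1; apply: lee_wpmul2l => //.
  by rewrite abse_EFin lee_fin indicE; case: (_ \in _); rewrite ?normr1 ?normr0.
Unshelve. all: by end_near. Qed.

(** The integrand is the derivative of [x^j gphi x], whose values at the ends of [[-(n+1), n+1]]
    tend to 0; [n.+1] keeps the interval nondegenerate. *)
Lemma integral_derive_pow_gphi (j : nat) :
  (\int[mu]_x ((j%:R * x ^+ j.-1 - x ^+ j.+1) * gphi x)%:E = 0)%E.
Proof.
pose G (x : R) := (j%:R * x ^+ j.-1 - x ^+ j.+1) * gphi x.
have GE x : G x = j%:R * (x ^+ j.-1 * gphi x) - x ^+ j.+1 * gphi x by rewrite /G; ring.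
have iG : mu.-integrable setT (EFin \o G).
  have -> : EFin \o G = (fun x => j%:R%:E * (x ^+ j.-1 * gphi x)%:E
      - (x ^+ j.+1 * gphi x)%:E)%E.
    by apply/funext => x; rewrite /= GE EFinB EFinM.
  apply: integrableB => //; last exact: integrable_pow_gphi.
  by apply: integrableZl => //; exact: integrable_pow_gphi.
have cG : continuous G.
  have -> : G = (fun x => j%:R * (x ^+ j.-1 * gphi x) - x ^+ j.+1 * gphi x) by exact/funext.
  move=> x; apply: cvgB; last exact: continuous_pow_gphi.
  by apply: cvgM; [exact: cvg_cst|exact: continuous_pow_gphi].
pose F (x : R) := x ^+ j * gphi x.
have FTC n : (\int[mu]_(x in `[(- n.+1%:R)%R, n.+1%:R%R]) (G x)%:E =
    (F n.+1%:R - F (- n.+1%:R))%:E)%E.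
  rewrite (@continuous_FTC2 R G F) //.
  - by rewrite -subr_gt0 opprK addr_gt0.
  - exact: continuous_subspaceT.
  - split.
    + by move=> x _; apply: ex_derive; exact: is_derive_pow_gphi.
    + by apply: cvg_at_right_filter; exact: continuous_pow_gphi.
    + by apply: cvg_at_left_filter; exact: continuous_pow_gphi.
  - by move=> x _; rewrite derive1E; apply: derive_val; exact: is_derive_pow_gphi.
have [C C0 HC] := pow_gphi_le j.
have lim0 : (F n.+1%:R - F (- n.+1%:R))%:E @[n --> \oo] --> 0%:E.
  apply: cvg_EFin; first exact: nearW.
  apply: norm_cvg0; apply: (@squeeze_cvgr _ _ _ _ (cst 0) (fun n => 4 * C * harmonic n.+1)).
  - near=> n; rewrite normr_ge0 /=.
    apply: le_trans (ler_normB _ _) _.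
    have H1 := HC n.+1%:R; have H2 := HC (- n.+1%:R).
    have K1 : gmaj (n.+1%:R) <= 2 * harmonic n.+1 by apply: gmaj_le_harmonic; rewrite normr_nat.
    have K2 : gmaj (- n.+1%:R) <= 2 * harmonic n.+1.
      by apply: gmaj_le_harmonic; rewrite normrN normr_nat.
    apply: le_trans (lerD H1 H2) _; rewrite -mulrDr.
    have -> : 4 * C * harmonic n.+1 = C * (2 * harmonic n.+1 + 2 * harmonic n.+1 : R) by ring.
    by apply: ler_wpM2l => //; exact: lerD.
  - exact: cvg_cst.
  - rewrite -[X in _ --> X](mulr0 (4 * C)); apply: cvgM; first exact: cvg_cst.
    by have := @cvg_harmonic R; rewrite -cvg_shiftS.
have := cvg_itv_integral iG; rewrite -cvg_shiftS /=.
under eq_fun do rewrite FTC.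
by move=> H; exact: (cvg_unique _ H lim0).
Unshelve. all: by end_near. Qed.

Let N : probability (measurableTypeR R) R := normal_prob 0 1.

Lemma ge0_integral_normal (f : R -> R) : (forall x, 0 <= f x) -> measurable_fun setT f ->
  (\int[N]_x (f x)%:E = \int[mu]_x (f x * gphi x)%:E)%E.
Proof.
move=> f0 mf.
have mg : measurable_fun setT gphi by rewrite -normal_pdf01; exact: measurable_normal_pdf.
have := @ge0_integral_transfer _ _ (measurableTypeR R) (measurableTypeR R) R mu N id gphi 1
  (fun x => (f x)%:E).
rewrite mul1e => <- //.
- by apply: eq_integral => x _; rewrite -EFinM mulrC.
- exact: gphi_ge0.
- move=> B mB; rewrite mul1e [RHS]integral_mkcond; apply: eq_integral => x _.
  by rewrite epatch_indic /= normal_pdf01 EFinM.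
- by apply/measurable_EFinP; exact: mf.
Qed.

Lemma measurable_pow (k : nat) : measurable_fun setT (fun x : R => x ^+ k).
Proof. by apply: continuous_measurable_fun; exact: exprn_continuous. Qed.

Lemma normal_pow_integrable (k : nat) : N.-integrable setT (fun x => (x ^+ k)%:E).
Proof.
apply/integrableP; split; first by apply/measurable_EFinP; exact: measurable_pow.
under eq_integral do rewrite abse_EFin.
rewrite ge0_integral_normal //; last first.
  by apply: measurableT_comp => //; exact: measurable_pow.
have /integrableP[_] := integrable_pow_gphi k.
congr (_ < _)%E; apply: eq_integral => x _.
by rewrite abse_EFin normrM [ `|gphi x|]ger0_norm ?gphi_ge0.
Qed.

Definition mom (k : nat) : R := fine (\int[N]_x (x ^+ k)%:E)%E.

(** [ge0_integral_normal] transfers nonnegative functions, so the power is split into its positive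
    and negative parts. *)
Lemma momE (k : nat) : mom k = fine (\int[mu]_x (x ^+ k * gphi x)%:E)%E.
Proof.
congr fine.
have mp : measurable_fun setT (fun x : R => 2^-1 * (`|x ^+ k| + x ^+ k)).
  apply: measurable_funM => //; apply: measurable_funD; last exact: measurable_pow.
  by apply: measurableT_comp => //; exact: measurable_pow.
have mm : measurable_fun setT (fun x : R => 2^-1 * (`|x ^+ k| - x ^+ k)).
  apply: measurable_funM => //; apply: measurable_funB; last exact: measurable_pow.
  by apply: measurableT_comp => //; exact: measurable_pow.
have fp0 (x : R) : 0 <= 2^-1 * (`|x ^+ k| + x ^+ k).
  by rewrite mulr_ge0 // -lerBlDr sub0r -normrN ler_norm.
have fm0 (x : R) : 0 <= 2^-1 * (`|x ^+ k| - x ^+ k).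
  by rewrite mulr_ge0 // subr_ge0 ler_norm.
have bp (x : R) : `|2^-1 * (`|x ^+ k| + x ^+ k)| <= `|x ^+ k|.
  rewrite normrM [ `|2^-1|]ger0_norm //.
  by apply: le_trans (ler_wpM2l _ (ler_normD _ _)) _; rewrite // normr_id; lra.
have bm (x : R) : `|2^-1 * (`|x ^+ k| - x ^+ k)| <= `|x ^+ k|.
  rewrite normrM [ `|2^-1|]ger0_norm //.
  by apply: le_trans (ler_wpM2l _ (ler_normB _ _)) _; rewrite // normr_id; lra.
have iNp : N.-integrable setT (fun x => (2^-1 * (`|x ^+ k| + x ^+ k))%:E).
  apply: (le_integrable measurableT _ _ (normal_pow_integrable k)).
    by apply/measurable_EFinP; exact: mp.
  by move=> x _; rewrite !abse_EFin lee_fin.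
have iNm : N.-integrable setT (fun x => (2^-1 * (`|x ^+ k| - x ^+ k))%:E).
  apply: (le_integrable measurableT _ _ (normal_pow_integrable k)).
    by apply/measurable_EFinP; exact: mm.
  by move=> x _; rewrite !abse_EFin lee_fin.
have mg : measurable_fun setT gphi by rewrite -normal_pdf01; exact: measurable_normal_pdf.
have imp : mu.-integrable setT (fun x => (2^-1 * (`|x ^+ k| + x ^+ k) * gphi x)%:E).
  apply: (le_integrable measurableT _ _ (integrable_pow_gphi k)).
    by apply/measurable_EFinP; exact: measurable_funM.
  by move=> x _; rewrite !abse_EFin lee_fin !(normrM _ (gphi x)) ler_wpM2r.
have imm : mu.-integrable setT (fun x => (2^-1 * (`|x ^+ k| - x ^+ k) * gphi x)%:E).
  apply: (le_integrable measurableT _ _ (integrable_pow_gphi k)).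
    by apply/measurable_EFinP; exact: measurable_funM.
  by move=> x _; rewrite !abse_EFin lee_fin !(normrM _ (gphi x)) ler_wpM2r.
transitivity (\int[N]_x ((2^-1 * (`|x ^+ k| + x ^+ k))%:E
    - (2^-1 * (`|x ^+ k| - x ^+ k))%:E))%E.
  by apply: eq_integral => x _; rewrite -EFinB; congr EFin; field.
rewrite (integralB measurableT iNp iNm) !ge0_integral_normal //.
rewrite -(integralB measurableT imp imm).
by apply: eq_integral => x _; rewrite -EFinB; congr EFin; field.
Qed.

(** Stein's identity for the power [x^j]; the case [j = 0] is the vanishing of the mean. *)
Lemma mom_rec (j : nat) : mom j.+1 = j%:R * mom j.-1.
Proof.
have := integral_derive_pow_gphi j.
have -> : (\int[mu]_x ((j%:R * x ^+ j.-1 - x ^+ j.+1) * gphi x)%:E =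
  \int[mu]_x (j%:R%:E * (x ^+ j.-1 * gphi x)%:E - (x ^+ j.+1 * gphi x)%:E))%E.
  by apply: eq_integral => x _; rewrite -EFinM -EFinB; congr EFin; ring.
have i1 := integrable_pow_gphi j.-1; have i2 := integrable_pow_gphi j.+1.
rewrite (integralB measurableT (integrableZl measurableT _ i1) i2) integralZl //.
have f1 := integrable_fin_num measurableT i1; have f2 := integrable_fin_num measurableT i2.
move=> /(congr1 fine); rewrite fineB // ?fin_numM // fineM // -!momE /=.
by move/eqP; rewrite subr_eq0 => /eqP <-.
Qed.

Lemma mom0 : mom 0 = 1.
Proof.
rewrite momE; under eq_integral do rewrite mul1r -normal_pdf01.
by rewrite integral_normal_pdf.
Qed.

Lemma mom1 : mom 1 = 0. Proof. by rewrite mom_rec mul0r. Qed.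
Lemma mom2 : mom 2 = 1. Proof. by rewrite mom_rec mom0 mulr1. Qed.
Lemma mom4 : mom 4 = 3. Proof. by rewrite mom_rec mom2 mulr1. Qed.

End gaussian.

(** * Polynomials in independent normal variables *)

(** Case analysis over all coincidences between indices in the goal, substituting in the equal
    branches; it enumerates the patterns of [Ex_mon4]. *)
Ltac decide_eqs := repeat (match goal with
  | |- context [?x == ?x] => rewrite eqxx
  | H : is_true (?x != ?y) |- context [?x == ?y] => rewrite (negbTE H)
  | H : is_true (?x != ?y) |- context [?y == ?x] => rewrite [y == x]eq_sym (negbTE H)
  | |- context [?x == ?y] => case: (eqVneq x y) => ?; [subst|]
  end; rewrite /= ?inE).

Section polynomial_rv.
Context {dT : measure_display} {T : measurableType dT} {R : realType} {I : eqType}.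
Variables (P : probability T R) (X : I -> T -> R).
Hypothesis mX : forall i, measurable_fun setT (X i).
Hypothesis indX : mutually_independent P X.
Hypothesis normX : forall i, std_normal P (X i).

Local Notation mom := (mom R).

(** A monomial is a list of indices with repetition, so that products of monomials are
    concatenations. *)
Definition mon (s : seq I) (w : T) : R := \prod_(p <- s) X p w.

Lemma mon_cat s1 s2 w : mon (s1 ++ s2) w = mon s1 w * mon s2 w.
Proof. by rewrite /mon big_cat. Qed.

Lemma mon_undup s w : mon s w = \prod_(p <- undup s) X p w ^+ count_mem p s.
Proof. by rewrite /mon -prodr_undup_exp_count. Qed.

Lemma mon_integrable s : P.-integrable setT (EFin \o mon s).
Proof.
have -> : EFin \o mon s = (fun w => (\prod_(p <- undup s) X p w ^+ count_mem p s)%:E).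
  by apply/funext => w; rewrite /= mon_undup.
apply: (@indep_prod_integrable _ _ _ _ P X mX indX normX (undup s)
  (fun p x => x ^+ count_mem p s)) => [|j]; first exact: undup_uniq.
exact: normal_pow_integrable.
Qed.

Definition Ex (Z : T -> R) : R := fine ('E_P[Z])%E.

Lemma Ex_mon s : Ex (mon s) = \prod_(p <- undup s) mom (count_mem p s).
Proof.
rewrite /Ex unlock; under eq_integral do rewrite mon_undup.
rewrite (@indep_prod _ _ _ _ P X mX indX normX (undup s)
  (fun p x => x ^+ count_mem p s)) // ?undup_uniq //.
by move=> j; exact: normal_pow_integrable.
Qed.

Lemma Ex_mon_cat s1 s2 : all (fun p => p \notin s2) s1 ->
  Ex (mon (s1 ++ s2)) = Ex (mon s1) * Ex (mon s2).
Proof.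
move=> /allP dis; rewrite !Ex_mon undup_cat big_cat /=; congr (_ * _).
  have -> : [seq x <- undup s1 | x \notin s2] = undup s1.
    by apply/all_filterP/allP => p; rewrite mem_undup => /dis.
  apply: eq_big_seq => p; rewrite mem_undup => /dis ps2.
  by rewrite count_cat (count_memPn ps2) addn0.
apply: eq_big_seq => p; rewrite mem_undup => ps2.
rewrite count_cat (_ : count_mem p s1 = 0%N) //; apply/count_memPn.
by apply/negP => /dis; rewrite ps2.
Qed.

Lemma Ex_mon2 a b : Ex (mon [:: a; b]) = (a == b)%:R.
Proof.
rewrite Ex_mon; have [->|ne] := eqVneq a b.
  by rewrite /= inE eqxx /= big_seq1 eqxx mom2.
by rewrite /= inE (negbTE ne) !big_cons big_nil eqxx /= eq_sym (negbTE ne) mom1 mul0r.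
Qed.

(** Isserlis' formula: one term for each pairing of four Gaussian factors. When all indices agree
    the three pairings add up to the fourth moment 3. *)
Lemma Ex_mon4 a b c e : Ex (mon [:: a; b; c; e]) =
  (a == b)%:R * (c == e)%:R + (a == c)%:R * (b == e)%:R + (a == e)%:R * (b == c)%:R.
Proof.
rewrite Ex_mon /= !inE; decide_eqs; rewrite ?big_cons ?big_nil /=; decide_eqs.
all: by rewrite ?addn0 ?add0n ?add1n ?mom1 ?mom2 ?mom4; ring.
Qed.

(** Stands in for integrability together with measurability with respect to the variables indexed by
    [D], in a form closed under the operations of the iteration. *)
Definition polyRV (D : pred I) (Z : T -> R) : Prop :=
  exists2 l : seq (R * seq I), all (fun cs => all D cs.2) l &
    Z = (fun w => \sum_(cs <- l) cs.1 * mon cs.2 w).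

Lemma polyRV_mon (D : pred I) s : all D s -> polyRV D (mon s).
Proof.
move=> Ds; exists [:: (1, s)]; first by rewrite /= Ds.
by apply/funext => w; rewrite big_seq1 mul1r.
Qed.

Lemma polyRV_cst (D : pred I) c : polyRV D (fun=> c).
Proof.
exists [:: (c, [::])] => //.
by apply/funext => w; rewrite big_seq1 /mon big_nil mulr1.
Qed.

Lemma polyRV_X (D : pred I) p : D p -> polyRV D (X p).
Proof.
move=> Dp; have -> : X p = mon [:: p] by apply/funext => w; rewrite /mon big_seq1.
by apply: polyRV_mon; rewrite /= Dp.
Qed.

Lemma polyRVD (D : pred I) Y Z : polyRV D Y -> polyRV D Z -> polyRV D (fun w => Y w + Z w).
Proof.
move=> [l1 D1 ->] [l2 D2 ->]; exists (l1 ++ l2); first by rewrite all_cat D1.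
by apply/funext => w; rewrite big_cat.
Qed.

Lemma polyRVM (D : pred I) Y Z : polyRV D Y -> polyRV D Z -> polyRV D (fun w => Y w * Z w).
Proof.
move=> [l1 D1 ->] [l2 D2 ->].
exists [seq (c1.1 * c2.1, c1.2 ++ c2.2) | c1 <- l1, c2 <- l2].
  apply/allP => _ /allpairsP[[c1 c2] /= [c1l c2l ->]] /=.
  by rewrite all_cat (allP D1 _ c1l) (allP D2 _ c2l).
apply/funext => w; rewrite big_allpairs_dep mulr_suml; apply: eq_bigr => c1 _.
by rewrite mulr_sumr; apply: eq_bigr => c2 _; rewrite mon_cat mulrACA.
Qed.

Lemma polyRVZ (D : pred I) c Z : polyRV D Z -> polyRV D (fun w => c * Z w).
Proof. by move=> DZ; apply: polyRVM => //; exact: polyRV_cst. Qed.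

Lemma polyRVN (D : pred I) Z : polyRV D Z -> polyRV D (fun w => - Z w).
Proof.
move=> DZ; have -> : (fun w => - Z w) = (fun w => -1 * Z w).
  by apply/funext => w; rewrite mulN1r.
exact: polyRVZ.
Qed.

Lemma polyRVB (D : pred I) Y Z : polyRV D Y -> polyRV D Z -> polyRV D (fun w => Y w - Z w).
Proof. by move=> DY DZ; apply: polyRVD => //; exact: polyRVN. Qed.

Lemma polyRV_sum (D : pred I) (J : finType) (F : J -> T -> R) :
  (forall j, polyRV D (F j)) -> polyRV D (fun w => \sum_j F j w).
Proof.
move=> DF; elim: (index_enum J) => [|j r IH].
  by under eq_fun do rewrite big_nil; exact: polyRV_cst.
by under eq_fun do rewrite big_cons; apply: polyRVD.
Qed.

Lemma polyRV_sub (D D' : pred I) Z : subpred D D' -> polyRV D Z -> polyRV D' Z.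
Proof.
move=> DD' [l Dl ->]; exists l => //; apply: sub_all Dl => cs.
exact: sub_all.
Qed.

Lemma polyRV_integrable (D : pred I) Z : polyRV D Z -> P.-integrable setT (EFin \o Z).
Proof.
move=> [l _ ->].
have -> : EFin \o (fun w => \sum_(cs <- l) cs.1 * mon cs.2 w) =
    (fun w => \sum_(cs <- l) (cs.1%:E * (mon cs.2 w)%:E))%E.
  by apply/funext => w; rewrite /= -sumEFin; apply: eq_bigr => cs _; rewrite EFinM.
apply: integrable_sum => // cs _; apply: integrableZl => //; exact: mon_integrable.
Qed.

Lemma Ex_fin (D : pred I) Z : polyRV D Z -> ('E_P[Z] \is a fin_num)%E.
Proof.
by move=> /polyRV_integrable iZ; rewrite unlock; exact: integrable_fin_num.
Qed.

Lemma ExD (D D' : pred I) Y Z : polyRV D Y -> polyRV D' Z ->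
  Ex (fun w => Y w + Z w) = Ex Y + Ex Z.
Proof.
move=> DY DZ; rewrite /Ex -fineD; [|exact: Ex_fin DY|exact: Ex_fin DZ].
congr fine; rewrite unlock -integralD //; try exact: polyRV_integrable DY; try exact: polyRV_integrable DZ.
Qed.

Lemma ExZ (D : pred I) c Z : polyRV D Z -> Ex (fun w => c * Z w) = c * Ex Z.
Proof.
move=> DZ; rewrite /Ex -[c in RHS]/(fine c%:E) -fineM //; last exact: Ex_fin DZ.
congr fine; rewrite unlock -integralZl //; exact: polyRV_integrable DZ.
Qed.

Lemma Ex_cst c : Ex (fun=> c) = c.
Proof. by rewrite /Ex (expectation_cst P c). Qed.

Lemma ExB (D D' : pred I) Y Z : polyRV D Y -> polyRV D' Z ->
  Ex (fun w => Y w - Z w) = Ex Y - Ex Z.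
Proof.
move=> DY DZ; rewrite (ExD DY (polyRVN DZ)); congr (_ + _).
have -> : (fun w => - Z w) = (fun w => -1 * Z w).
  by apply/funext => w; rewrite mulN1r.
by rewrite (ExZ _ DZ) mulN1r.
Qed.

Lemma Ex_sum (D : pred I) (J : finType) (F : J -> T -> R) :
  (forall j, polyRV D (F j)) -> Ex (fun w => \sum_j F j w) = \sum_j Ex (F j).
Proof.
(* Both sums become folds over the same list, which allows an induction on that list under the
   binder. *)
move=> DF; rewrite /= !unlock /reducebig /=.
elim: (index_enum J) => [|j r IH] /=; first exact: Ex_cst.
rewrite -IH; apply: (ExD (DF j)).
elim: r {IH} => [|k r IHr] /=; first exact: polyRV_cst.
exact: polyRVD.
Qed.

(** Linearity reduces this to monomials, whose moments factor because the index sets are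
    disjoint. *)
Lemma Ex_indep (D : pred I) Z s : polyRV D Z -> all (predC D) s ->
  Ex (fun w => Z w * mon s w) = Ex Z * Ex (mon s).
Proof.
move=> [l Dl ->] Ds.
elim: l Dl => [|cs l IH] /=.
  move=> _; have -> : (fun w => (\sum_(cs <- [::]) cs.1 * mon cs.2 w) * mon s w) = (fun=> 0).
    by apply/funext => w; rewrite big_nil mul0r.
  have -> : (fun w => \sum_(cs <- [::]) cs.1 * mon cs.2 w) = (fun=> 0).
    by apply/funext => w; rewrite big_nil.
  by rewrite Ex_cst mul0r.
case/andP => Dcs Dl.
have pl : polyRV predT (fun w => \sum_(cs <- l) cs.1 * mon cs.2 w).
  by exists l => //; apply/allP => c _; apply/allP.
have pm r : polyRV predT (mon r) by apply: polyRV_mon; apply/allP.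
have -> : (fun w => \sum_(cs0 <- cs :: l) cs0.1 * mon cs0.2 w) =
   (fun w => cs.1 * mon cs.2 w + \sum_(cs <- l) cs.1 * mon cs.2 w).
  by apply/funext => w; rewrite big_cons.
have -> : (fun w => (\sum_(cs0 <- cs :: l) cs0.1 * mon cs0.2 w) * mon s w) =
   (fun w => cs.1 * mon (cs.2 ++ s) w + (\sum_(cs <- l) cs.1 * mon cs.2 w) * mon s w).
  by apply/funext => w; rewrite big_cons mon_cat mulrDl mulrA.
rewrite (ExD (polyRVZ cs.1 (pm _)) (polyRVM pl (pm s))) (ExD (polyRVZ cs.1 (pm _)) pl).
rewrite IH // !(ExZ _ (pm _)) mulrDl; congr (_ + _).
rewrite Ex_mon_cat ?mulrA //; apply/allP => p /(allP Dcs) Dp.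
by apply/negP => /(allP Ds); rewrite /= Dp.
Qed.

End polynomial_rv.

(** * Expectations against a fresh Gaussian direction *)

Lemma sum_delta (R : pzRingType) (J : finType) (F : J -> R) (k : J) :
  \sum_l F l * (k == l)%:R = F k.
Proof.
rewrite (bigD1 k) //= eqxx mulr1 big1 ?addr0 // => l lk.
by rewrite eq_sym (negbTE lk) mulr0.
Qed.

Definition dir_coord (T : Type) (R : Type) d (u : nat -> 'I_d -> T -> R) (p : nat * 'I_d) : T -> R :=
  u p.1 p.2.

(** The inequality is strict because the state at time [t] is built from the directions before
    [u t], and [u t] is independent of it. *)
Definition past d (t : nat) : pred (nat * 'I_d) := fun p => (p.1 < t)%N.

Section gaussian_directions.
Context {dT : measure_display} {T : measurableType dT} {R : realType} {d : nat}.
Variables (P : probability T R) (u : nat -> 'I_d -> T -> R).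
Hypothesis iid : iid_std_gaussian_dirs P u.

Local Notation X := (dir_coord u).
Let mX p : measurable_fun setT (X p). Proof. by case: iid => h _ _; exact: h. Qed.
Let indX : mutually_independent P X. Proof. by case: iid. Qed.
Let normX p : std_normal P (X p). Proof. by case: iid => _ _ h; exact: h. Qed.

Local Notation pastRV t := (polyRV X (past t)).
Local Notation Ex := (Ex P).

Lemma expectation_pastRV t Z : pastRV t Z -> ('E_P[Z] = (Ex Z)%:E)%E.
Proof.
by move=> pZ; rewrite /Ex fineK //; exact: (Ex_fin mX indX normX pZ).
Qed.

Lemma Ex_ge0 t Z : pastRV t Z -> (forall w, 0 <= Z w) -> 0 <= Ex Z.
Proof.
move=> pZ Z0; rewrite -lee_fin -(expectation_pastRV pZ).
exact: expectation_ge0.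
Qed.

Lemma pastRV_sub t t' Z : (t <= t')%N -> pastRV t Z -> pastRV t' Z.
Proof.
by move=> tt'; apply: polyRV_sub => p /= pt; exact: leq_trans tt'.
Qed.

Lemma pastRV_dir t k : pastRV t.+1 (u t k).
Proof. by apply: (@polyRV_X _ _ _ _ X (past t.+1) (t, k)); rewrite /past /=. Qed.

Lemma Ex_past_dirs t Z (s : seq 'I_d) : pastRV t Z ->
  Ex (fun w => Z w * \prod_(k <- s) u t k w) =
    Ex Z * Ex (mon X [seq (t, k) | k <- s]).
Proof.
move=> pZ; rewrite -(Ex_indep mX indX normX pZ); last first.
  by apply/allP => _ /mapP[k _ ->]; rewrite /= /past ltnn.
by congr Ex; apply/funext => w; rewrite /mon big_map.
Qed.

Lemma Ex_past2 t Z k l : pastRV t Z ->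
  Ex (fun w => Z w * (u t k w * u t l w)) = Ex Z * (k == l)%:R.
Proof.
move=> pZ; have := Ex_past_dirs [:: k; l] pZ.
rewrite (Ex_mon2 mX indX normX) xpair_eqE eqxx /= => <-.
by congr Ex; apply/funext => w; rewrite !big_cons big_nil mulr1.
Qed.

Lemma Ex_past4 t Z k l m n : pastRV t Z ->
  Ex (fun w => Z w * (u t k w * u t l w * (u t m w * u t n w))) = Ex Z *
   ((k == l)%:R * (m == n)%:R + (k == m)%:R * (l == n)%:R + (k == n)%:R * (l == m)%:R).
Proof.
move=> pZ; have := Ex_past_dirs [:: k; l; m; n] pZ.
rewrite (Ex_mon4 mX indX normX) !xpair_eqE eqxx /= => <-.
by congr Ex; apply/funext => w; rewrite !big_cons big_nil; ring.
Qed.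

Section projections.
Variables (t : nat) (a : 'I_d -> T -> R) (o : 'I_d -> R).
Hypothesis pa : forall k, pastRV t (a k).

(** The fresh direction satisfies [E[u u^T] = 1]. In the applications [a] is [H y] and [o] is a
    fixed vector. *)
Lemma Ex_bilinear B : pastRV t B ->
  Ex (fun w => B w * ((\sum_k a k w * u t k w) * (\sum_l o l * u t l w))) =
  Ex (fun w => B w * \sum_k a k w * o k).
Proof.
move=> pB.
have pc k l : pastRV t (fun w => B w * a k w * o l).
  by apply: polyRVM; [apply: polyRVM|exact: polyRV_cst].
have pS k l : pastRV t.+1 (fun w => B w * a k w * o l * (u t k w * u t l w)).
  apply: polyRVM; first exact: (pastRV_sub (leqnSn t)).
  by apply: polyRVM; exact: pastRV_dir.
transitivity (Ex (fun w => \sum_k \sum_l B w * a k w * o l * (u t k w * u t l w))).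
  congr Ex; apply/funext => w; rewrite mulr_suml mulr_sumr; apply: eq_bigr => k _.
  by rewrite !mulr_sumr; apply: eq_bigr => l _; ring.
rewrite (Ex_sum mX indX normX (D := past t.+1)); last by move=> k; apply: polyRV_sum.
transitivity (\sum_k Ex (fun w => B w * a k w * o k)).
  apply: eq_bigr => k _; rewrite (Ex_sum mX indX normX (D := past t.+1)) //.
  under eq_bigr => l _ do rewrite (Ex_past2 _ _ (pc k l)).
  by rewrite (sum_delta (fun l => Ex (fun w => B w * a k w * o l))).
rewrite -(Ex_sum mX indX normX (D := past t)) //; congr Ex; apply/funext => w.
by rewrite mulr_sumr; apply: eq_bigr => k _; rewrite mulrA.
Qed.

Lemma Ex_biquadratic :
  Ex (fun w => ((\sum_k a k w * u t k w) * (\sum_l o l * u t l w)) ^+ 2) =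
  Ex (fun w => \sum_k a k w ^+ 2) * (\sum_l o l ^+ 2)
   + 2 * Ex (fun w => (\sum_k a k w * o k) ^+ 2).
Proof.
have pc k l : pastRV t (fun w => a k w * a l w) by apply: polyRVM.
have pc4 k l m n : pastRV t (fun w => a k w * a l w * (o m * o n)).
  by apply: polyRVM => //; exact: polyRV_cst.
have pS k l m n : pastRV t.+1 (fun w => a k w * a l w * (o m * o n) *
    (u t k w * u t l w * (u t m w * u t n w))).
  apply: polyRVM; first exact: (pastRV_sub (leqnSn t)).
  by apply: polyRVM; apply: polyRVM; exact: pastRV_dir.
pose A k l := Ex (fun w => a k w * a l w).
have AE k l m n : Ex (fun w => a k w * a l w * (o m * o n)) = A k l * (o m * o n).
  transitivity (Ex (fun w => o m * o n * (a k w * a l w))).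
    by congr Ex; apply/funext => w; ring.
  by rewrite (ExZ mX indX normX _ (pc k l)) mulrC.
transitivity (Ex (fun w => \sum_k \sum_l \sum_m \sum_n a k w * a l w * (o m * o n) *
    (u t k w * u t l w * (u t m w * u t n w)))).
  congr Ex; apply/funext => w; rewrite exprMn !expr2 mulr_suml mulr_suml.
  apply: eq_bigr => k _; rewrite mulr_sumr mulr_suml.
  apply: eq_bigr => l _; rewrite mulr_suml mulr_sumr.
  apply: eq_bigr => m _; rewrite !mulr_sumr.
  by apply: eq_bigr => n _; ring.
have pS1 k l m : pastRV t.+1 (fun w => \sum_n a k w * a l w * (o m * o n) *
    (u t k w * u t l w * (u t m w * u t n w))) by apply: polyRV_sum.
have pS2 k l : pastRV t.+1 (fun w => \sum_m \sum_n a k w * a l w * (o m * o n) *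
    (u t k w * u t l w * (u t m w * u t n w))) by apply: polyRV_sum.
have pS3 k : pastRV t.+1 (fun w => \sum_l \sum_m \sum_n a k w * a l w * (o m * o n) *
    (u t k w * u t l w * (u t m w * u t n w))) by apply: polyRV_sum.
rewrite (Ex_sum mX indX normX (D := past t.+1)) //.
(* Of the three pairings, [k = l, m = n] gives the product of the squared norms; each of the other
   two gives the squared inner product. *)
transitivity (\sum_k \sum_l (A k l * (k == l)%:R * (\sum_m o m ^+ 2) + 2 * (A k l * (o k * o l)))).
  apply: eq_bigr => k _; rewrite (Ex_sum mX indX normX (D := past t.+1)) //.
  apply: eq_bigr => l _; rewrite (Ex_sum mX indX normX (D := past t.+1)) //.
  transitivity (\sum_m (A k l * (k == l)%:R * o m ^+ 2
     + (A k l * (o m * o l)) * (k == m)%:R + (A k l * (o m * o k)) * (l == m)%:R)).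
    apply: eq_bigr => m _; rewrite (Ex_sum mX indX normX (D := past t.+1)) //.
    transitivity (\sum_n ((A k l * (k == l)%:R * (o m * o n)) * (m == n)%:R
      + (A k l * (k == m)%:R * (o m * o n)) * (l == n)%:R
      + (A k l * (l == m)%:R * (o m * o n)) * (k == n)%:R)).
      by apply: eq_bigr => n _; rewrite (Ex_past4 _ _ _ _ (pc4 k l m n)) AE; ring.
    by rewrite !big_split /= !sum_delta; ring.
  rewrite !big_split /= !sum_delta -mulr_sumr; ring.
under eq_bigr do rewrite big_split /= -mulr_suml -mulr_sumr.
rewrite big_split /= -mulr_suml -mulr_sumr; congr (_ * _ + _ * _).
  rewrite (Ex_sum mX indX normX (D := past t)); last first.
    by move=> k; exact: (pc k k).
  by apply: eq_bigr => k _; rewrite sum_delta /A; congr Ex.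
transitivity (Ex (fun w => \sum_k \sum_l a k w * a l w * (o k * o l))).
  rewrite (Ex_sum mX indX normX (D := past t)); last by move=> k; apply: polyRV_sum.
  apply: eq_bigr => k _; rewrite (Ex_sum mX indX normX (D := past t)) //.
  by apply: eq_bigr => l _; rewrite AE.
congr Ex; apply/funext => w; rewrite expr2 mulr_suml; apply: eq_bigr => k _.
by rewrite mulr_sumr; apply: eq_bigr => l _; ring.
Qed.

End projections.
End gaussian_directions.

(** * Recursions for first and second moments *)

Section mean_recursion.
Variable R : archiRealFieldType.
(* [z t] is [x (t - 1) - x t], so [x t + z t] is the previous iterate. *)
Variables (b a : R) (x z : nat -> R).
Hypothesis b01 : 0 <= b < 1.
Hypothesis z0 : z 0%N = 0.
Hypothesis zS : forall t, z t.+1 = b * z t + a * x t.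
Hypothesis xS : forall t, x t.+1 = x t - z t.+1.

Lemma mean_recursion_bounded : 0 <= a < 2 * (1 + b) ->
  exists M, forall t, x t ^+ 2 <= M.
Proof.
(* For [a = 0] the form [W] is only semidefinite, but then the iterate is constant because [z]
   starts at 0. *)
move=> /andP[a0 a2]; have /andP[b0 b1] := b01; have [aE|an] := eqVneq a 0.
  have E t : z t = 0 /\ x t = x 0%N.
    elim: t => [//|t [zt xt]]; have zt1 : z t.+1 = 0 by rewrite zS zt aE; ring.
    by rewrite xS zt1 xt subr0.
  by exists (x 0%N ^+ 2) => t; rewrite (E t).2.
have ap : 0 < a by rewrite lt_neqAle eq_sym an.
pose c := 1 + b - a.
pose W t := (1 + b) * (x t ^+ 2 + (x t + z t) ^+ 2) - 2 * c * x t * (x t + z t).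
have Wdec t : W t.+1 <= W t.
  have -> : W t.+1 = W t - (1 - b) * (x t.+1 - (x t + z t)) ^+ 2.
    by rewrite /W /c xS zS; ring.
  by rewrite gerDl oppr_le0 mulr_ge0 ?sqr_ge0 //; lra.
have W0 t : W t <= W 0%N by elim: t => // t; apply: le_trans.
(* The sign of [c] decides which way of completing squares has nonnegative coefficients. *)
have [c0|c0] := leP 0 c.
  exists (W 0%N / a) => t; rewrite ler_pdivlMr // mulrC.
  apply: le_trans (W0 t); rewrite -subr_ge0.
  have -> : W t - a * x t ^+ 2 = a * (x t + z t) ^+ 2 + c * z t ^+ 2.
    by rewrite /W /c; ring.
  by rewrite addr_ge0 // mulr_ge0 ?sqr_ge0.
have e0 : 0 < 2 * (1 + b) - a by lra.
exists (W 0%N / (2 * (1 + b) - a)) => t; rewrite ler_pdivlMr // mulrC.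
apply: le_trans (W0 t); rewrite -subr_ge0.
have -> : W t - (2 * (1 + b) - a) * x t ^+ 2 =
    (2 * (1 + b) - a) * (x t + z t) ^+ 2 + (- c) * (2 * x t + z t) ^+ 2.
  by rewrite /W /c; ring.
by rewrite addr_ge0 // mulr_ge0 ?sqr_ge0 ?oppr_ge0 // ltW.
Qed.

Lemma mean_recursion_unbounded : 2 * (1 + b) < a -> x 0%N = 1 ->
  ~ exists M, forall t, x t ^+ 2 <= M.
Proof.
move=> ab x01 [M HM]; pose e := a - 2 * (1 + b).
have e0 : 0 < e by rewrite /e; lra.
have eE : e = a - 2 * (1 + b) by []; clearbody e.
have /andP[b0 b1] := b01.
(* The second quantity is the increment [(-1)^t x_t - (-1)^(t-1) x_(t-1)]. *)
have inv t : 1 + e * t%:R <= (-1) ^+ t * x t /\ 0 <= (-1) ^+ t * (2 * x t + z t).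
  elim: t => [|t [IH1 IH2]]; first by rewrite expr0 x01 z0 mulr0; split; lra.
  have E : (-1) ^+ t.+1 * x t.+1 =
     (-1) ^+ t * x t + (e * ((-1) ^+ t * x t) + b * ((-1) ^+ t * (2 * x t + z t))).
    by rewrite exprS xS zS eE; ring.
  have et : 0 <= e * t%:R by rewrite mulr_ge0 // ltW.
  have q1 : 1 <= (-1) ^+ t * x t by apply: le_trans IH1; rewrite lerDl.
  have p1 : e <= e * ((-1) ^+ t * x t) by rewrite ler_peMr // ltW.
  have p2 : 0 <= b * ((-1) ^+ t * (2 * x t + z t)) by rewrite mulr_ge0.
  split; first by rewrite E -natr1 mulrDr mulr1; lra.
  have -> : (-1) ^+ t.+1 * (2 * x t.+1 + z t.+1) = (-1) ^+ t.+1 * x t.+1 - (-1) ^+ t * x t.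
    by rewrite exprS xS; ring.
  by rewrite E; lra.
have M0 : 0 <= M by apply: le_trans (HM 0%N); exact: sqr_ge0.
have := archi_boundP (divr_ge0 M0 (ltW e0)).
set n := Num.bound _; rewrite ltr_pdivrMr // mulrC => Mn.
have [h _] := inv n; have := HM n.
have -> : x n ^+ 2 = ((-1) ^+ n * x n) ^+ 2 by rewrite exprMn sqrr_sign mul1r.
move: h; set y := _ * x n => h1 h2.
have y1 : 1 <= y by lra.
have : y <= y ^+ 2 by rewrite expr2 ler_peMl //; lra.
lra.
Qed.

End mean_recursion.

(** [V] never decreases, so [Q t.+1 + Q t] stays above [V 0 / K] and [V] gains a fixed amount every
    two steps; a bounded [Q] would bound [V]. *)
Lemma growth_unbounded (R : archiRealFieldType) (V Q : nat -> R) (k K : R) :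
  0 < V 0%N -> 0 < k -> 0 < K -> (forall t, 0 <= Q t) ->
  (forall t, V t + k * Q t <= V t.+1) -> (forall t, V t.+1 <= K * (Q t.+1 + Q t)) ->
  ~ exists M, forall t, Q t <= M.
Proof.
move=> V0 k0 K0 Q0 VS VK [M HM].
have Vnd t : V t <= V t.+1.
  by apply: le_trans (VS t); rewrite lerDl mulr_ge0 // ltW.
have V0t t : V 0%N <= V t by elim: t => // t IH; exact: le_trans IH (Vnd t).
pose e := k * (V 0%N / K).
have e0 : 0 < e by rewrite mulr_gt0 // divr_gt0.
have eE : k * (V 0%N / K) = e by []; clearbody e.
have V2 t : V t + e <= V t.+2.
  have h1 := VS t; have h2 := VS t.+1.
  have : V 0%N / K <= Q t.+1 + Q t.
    by rewrite ler_pdivrMr // mulrC; exact: le_trans (V0t _) (VK t).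
  by rewrite -(ler_pM2l k0) eE mulrDr; lra.
have Vn n : V 0%N + n%:R * e <= V (n.*2).
  elim: n => [|n IH]; first by rewrite mul0r addr0.
  by apply: le_trans (V2 _); rewrite -natr1 mulrDl mul1r addrA lerD2r.
have M0 : 0 <= M by apply: le_trans (HM 0%N).
have B0 : 0 <= K * (M + M) / e by rewrite divr_ge0 ?mulr_ge0 ?addr_ge0 // ltW.
have := archi_boundP B0.
set n := Num.bound _; rewrite ltr_pdivrMr // => Mn.
case: n Mn => [|n] Mn.
  by move: Mn; rewrite mul0r ltNge mulr_ge0 ?addr_ge0 // ltW.
have := Vn n.+1; rewrite doubleS => h.
have := VK n.*2.+1; have := HM n.*2.+2; have := HM n.*2.+1 => h1 h2 h3.
have h4 : K * (Q n.*2.+2 + Q n.*2.+1) <= K * (M + M) by rewrite ler_pM2l //; exact: lerD.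
lra.
Qed.

(** * Lyapunov functions for the second-moment recursion *)

Section second_moments.
Variable R : archiRealFieldType.
Variables (d : nat) (lam : 'I_d -> R) (b eta : R) (Y C N : nat -> 'I_d -> R).
Hypothesis b01 : 0 <= b < 1.
Hypothesis eta0 : 0 < eta.
Hypothesis lam0 : forall i, 0 <= lam i.
Let g := (1 - b) * eta.
Let S t := \sum_i lam i ^+ 2 * Y t i.
Hypothesis N0 : forall i, N 0%N i = 0.
Hypothesis C0 : forall i, C 0%N i = 0.
Hypothesis NS : forall t i, N t.+1 i = b ^+ 2 * N t i + 2 * b * g * lam i * C t i
  + g ^+ 2 * (2 * lam i ^+ 2 * Y t i + S t).
Hypothesis CS : forall t i, C t.+1 i = b * C t i + g * lam i * Y t i - N t.+1 i.
Hypothesis YS : forall t i,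
  Y t.+1 i = Y t i - 2 * (b * C t i + g * lam i * Y t i) + N t.+1 i.
(** For the iterates this is the second moment of [p z + q y]; suitable choices of [p] and [q] give
    the estimates on [W] below. *)
Hypothesis psdYN : forall t i (p q : R),
  0 <= p ^+ 2 * N t i + 2 * p * q * C t i + q ^+ 2 * Y t i.

Let X i := eta * lam i / (1 + b).
(* The coefficients of [W] are the solution of the linear system that says that
   [W t.+1 i - W t i] involves neither [N t i] nor [C t i]. *)
Let cc i := (1 - b) ^+ 2 + 2 * b * g * lam i / (1 + b).
Let bb i := - 2 * b * (1 - b) + 2 * b * g * lam i / (1 + b).
Let W t i := b ^+ 2 * N t i + bb i * C t i + cc i * Y t i.

Let b0 : 0 <= b. Proof. by case/andP: b01. Qed.
Let b1 : b < 1. Proof. by case/andP: b01. Qed.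
Let bp : 0 < 1 + b. Proof. by rewrite ltr_pwDl. Qed.
Let b1m : 0 < 1 - b. Proof. by rewrite subr_gt0. Qed.
Let g0 : 0 < g. Proof. by rewrite mulr_gt0. Qed.
Let bpn : 1 + b != 0. Proof. by rewrite gt_eqF. Qed.

Let Y_ge0 t i : 0 <= Y t i.
Proof. by have := psdYN t i 0 1; rewrite !expr0n /= expr1n; lra. Qed.

Let N_ge0 t i : 0 <= N t i.
Proof. by have := psdYN t i 1 0; rewrite !expr0n /= expr1n; lra. Qed.

Let S_ge0 t : 0 <= S t.
Proof. by apply: sumr_ge0 => i _; rewrite mulr_ge0 ?sqr_ge0. Qed.

Let WS t i : W t.+1 i = W t i + g ^+ 2 * S t - 2 * g * lam i * (1 - b) * (1 - X i) * Y t i.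
Proof. by rewrite /W YS CS NS /bb /cc /X /g; field. Qed.

(** [p = b] and [q = - (1 - b) (1 - X i)] match the coefficients of [N] and [C] in [W], so the
    difference of the two sides is exactly the semidefinite form. *)
Let W_ge t i : (1 - b) * X i * (2 - (1 - b) * X i) * Y t i <= W t i.
Proof.
rewrite -subr_ge0; have := psdYN t i b (- ((1 - b) * (1 - X i))).
by congr (_ <= _); rewrite /W /bb /cc /X /g; field.
Qed.

Let W_le t i : W t.+1 i <= (2 * b ^+ 2 + 2 * `|bb i| + `|cc i|) * (Y t.+1 i + Y t i).
Proof.
(* This reflects [y_t = y_(t+1) + z_(t+1)]: two consecutive values of [Y] control [C] and [N]. *)
have YE : Y t i = Y t.+1 i + 2 * C t.+1 i + N t.+1 i by rewrite YS CS; ring.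
have h1 := psdYN t.+1 i 1 2; have h2 := psdYN t.+1 i 1 1; have h3 := psdYN t.+1 i 1 (-1).
have y0 := Y_ge0 t.+1 i; have y1 := Y_ge0 t i; have n0 := N_ge0 t.+1 i.
have NN : N t.+1 i <= 2 * (Y t.+1 i + Y t i) by lra.
have Cn : `|C t.+1 i| <= 2 * (Y t.+1 i + Y t i) by rewrite ler_norml; apply/andP; split; lra.
have b20 := sqr_ge0 b.
have e1 : b ^+ 2 * N t.+1 i <= b ^+ 2 * (2 * (Y t.+1 i + Y t i)) by rewrite ler_wpM2l.
have e2 : bb i * C t.+1 i <= `|bb i| * (2 * (Y t.+1 i + Y t i)).
  by apply: le_trans (ler_norm _) _; rewrite normrM ler_wpM2l.
have e3 : cc i * Y t.+1 i <= `|cc i| * (Y t.+1 i + Y t i).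
  apply: le_trans (ler_norm _) _; rewrite normrM ler_wpM2l // ger0_norm //; lra.
by rewrite /W; lra.
Qed.

Let cc_gt0 i : 0 < cc i.
Proof.
rewrite /cc ltr_pwDl ?exprn_gt0 //; apply: divr_ge0; last exact: ltW.
by rewrite !mulr_ge0 // ltW.
Qed.

Let s i := eta * lam i / (2 * (1 - X i)).
Let F := \sum_i s i.
Let L t := \sum_i s i * W t i.

Section contracting.
Hypothesis X1 : forall i, eta * lam i < 1 + b.

Let X_lt1 i : X i < 1. Proof. by rewrite /X ltr_pdivrMr // mul1r. Qed.
Let X_ge0 i : 0 <= X i.
Proof. by apply: divr_ge0; [rewrite mulr_ge0 // ltW|exact: ltW]. Qed.
Let s_ge0 i : 0 <= s i.
Proof.
by apply: divr_ge0; [rewrite mulr_ge0 // ltW|rewrite mulr_ge0 // subr_ge0 ltW].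
Qed.

Let LS t : L t.+1 = L t + g ^+ 2 * (F - 1) * S t.
Proof.
have -> : g ^+ 2 * (F - 1) * S t =
   \sum_i (s i * (g ^+ 2 * S t) - g ^+ 2 * (lam i ^+ 2 * Y t i)).
  by rewrite sumrB -mulr_suml -mulr_sumr -/F -/(S t); ring.
rewrite /L -big_split /=; apply: eq_bigr => i _.
rewrite WS /s /g /X; field.
by rewrite bpn /= subr_eq0 gt_eqF.
Qed.

Let kap i := (1 - b) * X i * (2 - (1 - b) * X i).

Let bX_le1 i : (1 - b) * X i <= 1.
Proof.
by apply: mulr_ile1; [exact: ltW|exact: X_ge0|rewrite gerBl|exact/ltW/X_lt1].
Qed.

Let kap_ge0 i : 0 <= kap i.
Proof.
rewrite /kap; apply: mulr_ge0; first by rewrite mulr_ge0 // ltW.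
have := bX_le1 i.
lra.
Qed.

Let W_ge0 t i : 0 <= W t i.
Proof. by apply: le_trans (W_ge t i); rewrite mulr_ge0 // kap_ge0. Qed.

Lemma second_moments_bounded : F < 1 -> exists M, forall t i, Y t i <= M.
Proof.
move=> F1; have g20 : 0 < g ^+ 2 by rewrite exprn_gt0.
have k0 : 0 < g ^+ 2 * (1 - F) by rewrite mulr_gt0 // subr_gt0.
have LE t : L t + g ^+ 2 * (1 - F) * \sum_(r < t) S r = L 0%N.
  elim: t => [|t IH]; first by rewrite big_ord0 mulr0 addr0.
  by rewrite -IH big_ord_recr /= LS; ring.
have L_ge0 t : 0 <= L t by apply: sumr_ge0 => i _; rewrite mulr_ge0.
have SS_ge0 t : 0 <= \sum_(r < t) S r by exact: sumr_ge0.
have LL t : L t <= L 0%N by rewrite -(LE t) lerDl mulr_ge0 // ltW.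
pose B := L 0%N / (g ^+ 2 * (1 - F)).
have SB t : \sum_(r < t) S r <= B.
  by rewrite /B ler_pdivlMr // mulrC -(LE t) lerDr.
have bnd i : exists M, forall t, Y t i <= M.
  (* For [lam i = 0] both [s i] and [kap i] vanish and [L] says nothing about [Y t i]; there [W] and
     [N] are bounded through the partial sums of [S]. *)
  have [li|li] := eqVneq (lam i) 0; last first.
    have lp : 0 < lam i by rewrite lt_neqAle eq_sym li lam0.
    have Xp : 0 < X i by rewrite /X divr_gt0 ?mulr_gt0.
    have sp : 0 < s i by rewrite /s divr_gt0 ?mulr_gt0 ?subr_gt0.
    have kp : 0 < kap i.
      rewrite /kap; apply: mulr_gt0; first exact: mulr_gt0.
      have := bX_le1 i.
      lra.
    exists (L 0%N / s i / kap i) => t; rewrite ler_pdivlMr // mulrC.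
    apply: le_trans (W_ge t i) _; rewrite ler_pdivlMr // mulrC.
    apply: le_trans (LL t); rewrite /L (bigD1 i) //= lerDl.
    by apply: sumr_ge0 => j _; rewrite mulr_ge0.
  have WE t : W t i = W 0%N i + g ^+ 2 * \sum_(r < t) S r.
    elim: t => [|t IH]; first by rewrite big_ord0 mulr0 addr0.
    by rewrite WS IH li big_ord_recr /=; ring.
  have NE t : N t i <= g ^+ 2 * \sum_(r < t) S r.
    elim: t => [|t IH]; first by rewrite big_ord0 mulr0 N0.
    rewrite big_ord_recr /= mulrDr NS li expr0n /= !(mulr0, mul0r, addr0, add0r).
    rewrite lerD2r; apply: le_trans IH; rewrite ler_piMl // expr_le1 // ltW //.
  exists ((2 * (W 0%N i + g ^+ 2 * B) + 2 * b ^+ 2 * (g ^+ 2 * B)) / (1 - b) ^+ 2) => t.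
  rewrite ler_pdivlMr ?exprn_gt0 // mulrC.
  (* The expectation of [((1-b) y)^2 <= 2 (b z - (1-b) y)^2 + 2 (b z)^2]; for [lam i = 0], [W] is
     the second moment of [b z - (1-b) y]. *)
  have h := psdYN t i (2 * b) (- (1 - b)).
  have e1 : W t i <= W 0%N i + g ^+ 2 * B by rewrite WE lerD2l ler_pM2l.
  have e2 : N t i <= g ^+ 2 * B by apply: le_trans (NE t) _; rewrite ler_pM2l.
  have e3 : b ^+ 2 * N t i <= b ^+ 2 * (g ^+ 2 * B) by rewrite ler_wpM2l // sqr_ge0.
  have e4 : W t i = b ^+ 2 * N t i + - 2 * b * (1 - b) * C t i + (1 - b) ^+ 2 * Y t i.
    by rewrite /W /bb /cc li; ring.
  have e5 : (1 - b) ^+ 2 * Y t i + ((2 * b) ^+ 2 * N t i + 2 * (2 * b) * - (1 - b) * C t i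
      + (- (1 - b)) ^+ 2 * Y t i) = 2 * W t i + 2 * (b ^+ 2 * N t i) by rewrite e4; ring.
  lra.
have [M HM] := boolp.choice bnd.
exists (\sum_i `|M i|) => t i; apply: le_trans (HM i t) _.
apply: le_trans (ler_norm _) _; rewrite (bigD1 i) //= lerDl.
exact: sumr_ge0.
Qed.

Lemma second_moments_unbounded_sum i : 0 < lam i -> 0 < Y 0%N i -> 1 < F ->
  ~ exists M, forall t i, Y t i <= M.
Proof.
move=> li Yi F1 [M HM].
(* Dividing by [lam j ^+ 2] bounds [Y j] by [S]. For [lam j = 0] the summand vanishes with [s j],
   and the final [1] keeps [K] positive. *)
pose K := \sum_j s j * (2 * b ^+ 2 + 2 * `|bb j| + `|cc j|) / lam j ^+ 2 + 1.
have K0j j : 0 <= 2 * b ^+ 2 + 2 * `|bb j| + `|cc j|.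
  by rewrite !addr_ge0 // ?mulr_ge0 ?sqr_ge0.
have K1j j : 0 <= s j * (2 * b ^+ 2 + 2 * `|bb j| + `|cc j|) / lam j ^+ 2.
  by rewrite divr_ge0 ?sqr_ge0 // mulr_ge0.
have K0 : 0 < K by rewrite /K ltr_wpDl // sumr_ge0.
apply: (@growth_unbounded R L S (g ^+ 2 * (F - 1)) K) => //.
- have -> : L 0%N = \sum_j s j * (cc j * Y 0%N j).
    by apply: eq_bigr => j _; rewrite /W N0 C0; ring.
  rewrite (bigD1 i) //= ltr_pwDl //.
    apply: mulr_gt0; last by rewrite mulr_gt0.
    by rewrite /s divr_gt0 ?mulr_gt0 ?subr_gt0.
  apply: sumr_ge0 => j _; apply: mulr_ge0 => //; apply: mulr_ge0 => //; exact: ltW.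
- by rewrite mulr_gt0 ?exprn_gt0 // subr_gt0.
- by move=> t; rewrite LS.
- move=> t; rewrite /K mulrDl mul1r.
  apply: (@le_trans _ _ ((\sum_j s j * (2 * b ^+ 2 + 2 * `|bb j| + `|cc j|) / lam j ^+ 2)
     * (S t.+1 + S t))); last by rewrite lerDl addr_ge0.
  rewrite mulr_suml; apply: ler_sum => j _.
  have [lj|lj] := eqVneq (lam j) 0.
    by rewrite /s lj !(mulr0, mul0r).
  have l2 : 0 < lam j ^+ 2 by rewrite exprn_even_gt0.
  have SY r : Y r j <= S r / lam j ^+ 2.
    rewrite ler_pdivlMr // mulrC /S (bigD1 j) //= lerDl.
    by apply: sumr_ge0 => k _; rewrite mulr_ge0 ?sqr_ge0.
  apply: (le_trans (ler_wpM2l (s_ge0 j) (W_le t j))).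
  rewrite [leLHS]mulrA -[leRHS]mulrA; apply: ler_wpM2l; first exact: mulr_ge0.
  by rewrite [leRHS]mulrC mulrDl lerD.
- exists (\sum_j lam j ^+ 2 * M) => t; apply: ler_sum => j _.
  by rewrite ler_wpM2l ?sqr_ge0.
Qed.

End contracting.

(** Here [1 - X i <= 0], so [s i] is no positive weight. But the last term of [WS] no longer damps:
    [W] gains at least [g ^+ 2 * S t] at each step and alone serves as [V]. *)
Lemma second_moments_unbounded_max i : 0 < lam i -> 0 < Y 0%N i -> 1 + b <= eta * lam i ->
  ~ exists M, forall t i, Y t i <= M.
Proof.
move=> li Yi Xi [M HM].
have K0 : 0 < 2 * b ^+ 2 + 2 * `|bb i| + `|cc i|.
  rewrite ltr_wpDl ?normr_gt0 ?gt_eqF // addr_ge0 // ?mulr_ge0 ?sqr_ge0 //.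
apply: (@growth_unbounded R (W^~ i) (Y^~ i) (g ^+ 2 * lam i ^+ 2)
  (2 * b ^+ 2 + 2 * `|bb i| + `|cc i|)) => //=.
- by rewrite /W N0 C0 !mulr0 !add0r mulr_gt0.
- by rewrite mulr_gt0 ?exprn_gt0.
- move=> t; rewrite WS.
  have X1 : 1 <= X i by rewrite /X ler_pdivlMr // mul1r.
  have h1 : lam i ^+ 2 * Y t i <= S t.
    rewrite /S (bigD1 i) //= lerDl.
    by apply: sumr_ge0 => k _; rewrite mulr_ge0 ?sqr_ge0.
  have h2 : g ^+ 2 * lam i ^+ 2 * Y t i <= g ^+ 2 * S t.
    by rewrite -[leLHS]mulrA ler_pM2l ?exprn_gt0.
  have h3 : 2 * g * lam i * (1 - b) * (1 - X i) * Y t i <= 0.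
    apply: mulr_le0_ge0 => //; apply: mulr_ge0_le0; last by rewrite subr_le0.
    by rewrite !mulr_ge0 // ltW.
  apply: le_trans (lerD (lexx _) h2) _.
  by rewrite lerDl oppr_ge0.
- by exists M.
Qed.

End second_moments.

(** * The iterates of frozen ZO-Adam *)

Lemma mxE_subZ (R : pzRingType) m n (A B : 'M[R]_(m, n)) (c : R) i j :
  (A - c *: B) i j = A i j - c * B i j.
Proof. by rewrite !mxE. Qed.

(** On a quadratic the central difference is exact: the terms even in [mu] cancel, so the smoothing
    parameter disappears. *)
Lemma zo_grad_fquad (R : realType) d (fxs : R) (H : 'M[R]_d) (xs x v : 'cV[R]_d) (mu : R) :
  trmx H = H -> mu != 0 ->
  zo_grad (fquad fxs H xs) mu x v = ((v^T *m H *m (x - xs)) 0 0) *: v.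
Proof.
move=> symH mu0; rewrite /zo_grad; congr (_ *: _).
set y := x - xs.
have -> : x + mu *: v = xs + (y + mu *: v) by rewrite /y addrA addrCA subrr addr0.
have -> : x - mu *: v = xs + (y - mu *: v) by rewrite /y addrA addrCA subrr addr0.
rewrite /fquad ![xs + _ - xs]addrAC !subrr !add0r.
clearbody y.
have sw : y^T *m H *m v = v^T *m H *m y.
  by rewrite -{1}symH -mulmxA dot_colC trmx_mul trmxK -mulmxA.
have q c : qform H (y + c *: v) =
    qform H y + 2 * c * (v^T *m H *m y) 0 0 + c ^+ 2 * qform H v.
  rewrite /qform [(_ + _)^T]linearD /= [(_ *: _)^T]linearZ /= !mulmxDl !mulmxDr.
  rewrite -!scalemxAr -!scalemxAl sw !mxE; ring.
by rewrite -scaleNr !q; field.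
Qed.

Section dynamics.
Context {dT : measure_display} {T : measurableType dT} {R : realType} {d : nat}.
Variables (P : probability T R) (u : nat -> 'I_d -> T -> R).
Hypothesis iid : iid_std_gaussian_dirs P u.
Variables (fxs : R) (H Pc : 'M[R]_d) (xs : 'cV[R]_d) (eta beta1 mu : R) (x0 : 'cV[R]_d).
Hypothesis symH : trmx H = H.
Hypothesis mu_neq0 : mu != 0.
Local Notation pastRV t := (polyRV (dir_coord u) (past t)).
Local Notation Ex := (Ex P).
Let mX p : measurable_fun setT (dir_coord u p). Proof. by case: iid => h _ _; exact: h. Qed.
Let indX : mutually_independent P (dir_coord u). Proof. by case: iid. Qed.
Let normX p : std_normal P (dir_coord u p). Proof. by case: iid => _ _ h; exact: h. Qed.

Definition zoadam_y t w : 'cV[R]_d := zoadam_x u fxs H Pc xs eta beta1 mu x0 t w - xs.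
Definition zoadam_m t w : 'cV[R]_d :=
  (zoadam_state fxs H Pc xs eta beta1 mu x0 (dirs_at u w) t).2.
Definition zoadam_slope t w : R := ((dirs_at u w t)^T *m (H *m zoadam_y t w)) 0 0.

Lemma zoadam_mS t w : zoadam_m t.+1 w =
  beta1 *: zoadam_m t w + ((1 - beta1) * zoadam_slope t w) *: dirs_at u w t.
Proof.
rewrite /zoadam_slope /zoadam_m /zoadam_y /zoadam_x /=.
case: (zoadam_state _ _ _ _ _ _ _ _ _ t) => x m /=.
by rewrite zo_grad_fquad // scalerA mulmxA.
Qed.

Lemma zoadam_yS t w : zoadam_y t.+1 w =
  zoadam_y t w - eta *: (invmx Pc *m zoadam_m t.+1 w).
Proof.
rewrite /zoadam_m /zoadam_y /zoadam_x /=.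
case: (zoadam_state _ _ _ _ _ _ _ _ _ t) => x m /=.
by rewrite addrAC.
Qed.

Lemma zoadam_slopeE t w :
  zoadam_slope t w = \sum_k (H *m zoadam_y t w) k 0 * u t k w.
Proof.
by rewrite /zoadam_slope dot_colC dot_col; apply: eq_bigr => k _; rewrite !mxE.
Qed.

Lemma pastRV_mulmx t n (A : 'M[R]_(n, d)) (v : T -> 'cV[R]_d) i :
  (forall j, pastRV t (fun w => v w j 0)) -> pastRV t (fun w => (A *m v w) i 0).
Proof.
move=> pv; under eq_fun do rewrite mxE.
by apply: polyRV_sum => j; apply: polyRVZ.
Qed.

Lemma pastRV_zoadam t :
  (forall i, pastRV t (fun w => zoadam_y t w i 0)) /\
  (forall i, pastRV t (fun w => zoadam_m t w i 0)).
Proof.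
elim: t => [|t [IHy IHm]].
  split=> i; first exact: (polyRV_cst _ _ ((x0 - xs) i 0)).
  exact: (polyRV_cst _ _ ((0 : 'cV[R]_d) i 0)).
have tt := leqnSn t.
have pm i : pastRV t.+1 (fun w => zoadam_m t.+1 w i 0).
  under eq_fun do rewrite zoadam_mS zoadam_slopeE !mxE.
  apply: polyRVD; first by apply: polyRVZ; exact: pastRV_sub (IHm i).
  apply: polyRVM; last exact: pastRV_dir.
  apply: polyRVZ; apply: polyRV_sum => k; apply: polyRVM; last exact: pastRV_dir.
  by apply: pastRV_mulmx => j; exact: pastRV_sub (IHy j).
split=> // i; under eq_fun do rewrite zoadam_yS mxE_subZ.
apply: polyRVB; first exact: pastRV_sub (IHy i).
by apply: polyRVZ; exact: pastRV_mulmx.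
Qed.

Let py t i : pastRV t (fun w => zoadam_y t w i 0). Proof. exact: (pastRV_zoadam t).1. Qed.
Let pm t i : pastRV t (fun w => zoadam_m t w i 0). Proof. exact: (pastRV_zoadam t).2. Qed.

Definition Exv (v : T -> 'cV[R]_d) : 'cV[R]_d := \col_i Ex (fun w => v w i 0).

Lemma Ex_mulmx t n (A : 'M[R]_(n, d)) (v : T -> 'cV[R]_d) i :
  (forall j, pastRV t (fun w => v w j 0)) ->
  Ex (fun w => (A *m v w) i 0) = (A *m Exv v) i 0.
Proof.
move=> pv; rewrite mxE.
transitivity (Ex (fun w => \sum_j A i j * v w j 0)).
  by congr Ex; apply/funext => w; rewrite mxE.
rewrite (Ex_sum mX indX normX (D := past t)); last by move=> j; exact: polyRVZ.
by apply: eq_bigr => j _; rewrite (ExZ mX indX normX _ (pv j)) mxE.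
Qed.

Lemma Exv_mS t : Exv (zoadam_m t.+1) =
  beta1 *: Exv (zoadam_m t) + (1 - beta1) *: (H *m Exv (zoadam_y t)).
Proof.
apply/colP => i; rewrite !mxE.
pose a k w := (H *m zoadam_y t w) k 0.
have pa k : pastRV t (a k) by apply: pastRV_mulmx.
have pS : pastRV t.+1 (fun w => (\sum_k a k w * u t k w) *
    (\sum_l (delta_mx i 0 : 'cV[R]_d) l 0 * u t l w)).
  apply: polyRVM; apply: polyRV_sum => k; last by apply: polyRVZ; exact: pastRV_dir.
  by apply: polyRVM; [exact: pastRV_sub (pa k)|exact: pastRV_dir].
(* Coordinate [i] of [u t] is written as a projection on [e_i], the form that [Ex_bilinear]
   takes. *)
transitivity (Ex (fun w => beta1 * zoadam_m t w i 0 + (1 - beta1) *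
    ((\sum_k a k w * u t k w) * (\sum_l (delta_mx i 0 : 'cV[R]_d) l 0 * u t l w)))).
  congr Ex; apply/funext => w; rewrite zoadam_mS zoadam_slopeE !mxE.
  congr (_ + _); rewrite -mulrA; congr (_ * (_ * _)).
  rewrite (eq_bigr (fun l => u t l w * (i == l)%:R)) ?sum_delta // => l _.
  by rewrite mxE eqxx andbT mulrC eq_sym.
rewrite (ExD mX indX normX (polyRVZ _ (pm t i)) (polyRVZ _ pS)).
rewrite (ExZ mX indX normX _ (pm t i)) (ExZ mX indX normX _ pS).
congr (_ * _ + _ * _).
have := Ex_bilinear iid (fun l => (delta_mx i 0 : 'cV[R]_d) l 0) pa (polyRV_cst _ _ 1).
move=> E; transitivity (Ex (a i)); last by rewrite (Ex_mulmx _ _ (py t)) mxE.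
transitivity (Ex (fun w => 1 * ((\sum_k a k w * u t k w) *
    (\sum_l (delta_mx i 0 : 'cV[R]_d) l 0 * u t l w)))).
  by congr Ex; apply/funext => w; rewrite mul1r.
rewrite E; congr Ex; apply/funext => w; rewrite mul1r.
rewrite (eq_bigr (fun l => a l w * (i == l)%:R)) ?(sum_delta (a^~ w)) // => l _.
by rewrite mxE eqxx andbT eq_sym.
Qed.

Lemma Exv_yS t : Exv (zoadam_y t.+1) =
  Exv (zoadam_y t) - eta *: (invmx Pc *m Exv (zoadam_m t.+1)).
Proof.
apply/colP => i; rewrite mxE_subZ [LHS]mxE [Exv (zoadam_y t) i 0]mxE.
rewrite -(Ex_mulmx _ _ (pm t.+1)).
have pPm : pastRV t.+1 (fun w => (invmx Pc *m zoadam_m t.+1 w) i 0) by exact: pastRV_mulmx.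
rewrite -(ExZ mX indX normX _ pPm) -(ExB mX indX normX (py t i) (polyRVZ eta pPm)).
congr Ex; apply/funext => w.
by rewrite zoadam_yS mxE_subZ.
Qed.

End dynamics.

Lemma mxE_addZ (R : pzRingType) m n (A B : 'M[R]_(m, n)) (p q : R) i j :
  (p *: A + q *: B) i j = p * A i j + q * B i j.
Proof. by rewrite !mxE. Qed.

Section euclidean_norm.
Context {R : realType}.

Lemma enorm_sqr d (v : 'cV[R]_d) : enorm v ^+ 2 = \sum_i v i 0 ^+ 2.
Proof. by rewrite /enorm sqr_sqrtr // sumr_ge0 // => i _; rewrite sqr_ge0. Qed.

Lemma coord_le_enorm d (v : 'cV[R]_d) i : `|v i 0| <= enorm v.
Proof.
rewrite -sqrtr_sqr /enorm ler_wsqrtr // (bigD1 i) //= lerDl.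
by apply: sumr_ge0 => j _; rewrite sqr_ge0.
Qed.

Lemma abs_mulmx_le m d (A : 'M[R]_(m, d)) (v : 'cV[R]_d) i :
  `|(A *m v) i 0| <= (\sum_j `|A i j|) * enorm v.
Proof.
rewrite mxE; apply: le_trans (ler_norm_sum _ _ _) _.
rewrite mulr_suml; apply: ler_sum => j _.
by rewrite normrM ler_wpM2l // coord_le_enorm.
Qed.

Lemma sqr_mulmx_le m d (A : 'M[R]_(m, d)) (v : 'cV[R]_d) i :
  (A *m v) i 0 ^+ 2 <= (\sum_j `|A i j|) ^+ 2 * \sum_j v j 0 ^+ 2.
Proof.
rewrite -enorm_sqr -exprMn -[leLHS]real_normK ?num_real //.
rewrite lerXn2r ?nnegrE ?normr_ge0 ?abs_mulmx_le //.
by rewrite mulr_ge0 ?sqrtr_ge0 ?sumr_ge0.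
Qed.

End euclidean_norm.

(** * Stability of the mean *)

Section mean_stability.
Context {dT : measure_display} {T : measurableType dT} {R : realType} {d : nat}.
Variables (P : probability T R) (u : nat -> 'I_d -> T -> R).
Hypothesis iid : iid_std_gaussian_dirs P u.
Variables (fxs : R) (H Pc : 'M[R]_d) (xs : 'cV[R]_d) (eta beta1 mu : R) (lam : 'I_d -> R).
Hypothesis symH : trmx H = H.
Hypothesis mu_neq0 : mu != 0.
Hypothesis beta01 : 0 <= beta1 < 1.
Variable Q : 'M[R]_d.
Hypothesis QP : Q^T *m Pc *m Q = 1%:M.
Hypothesis QH : Q^T *m H *m Q = diag_mx (\row_i lam i).

Let PQ : Q *m (Q^T *m Pc) = 1%:M. Proof. exact: mulmx1C. Qed.

Let PcU : Pc \in unitmx.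
Proof.
have : \det (Q^T *m Pc *m Q) \is a GRing.unit by rewrite QP det1 unitr1.
by rewrite !det_mulmx !unitrM => /andP[/andP[]].
Qed.

Let Ey x0 t := Exv P (zoadam_y u fxs H Pc xs eta beta1 mu x0 t).
Let Em x0 t := Exv P (zoadam_m u fxs H Pc xs eta beta1 mu x0 t).
(** [Q^T P] is the inverse of [Q], so these are the coordinates of the mean error in the basis [Q].
    For the momentum, [Q^T] suffices because [Q^T P P^-1 = Q^T]. *)
Let xi x0 t : 'cV[R]_d := Q^T *m Pc *m Ey x0 t.
Let ze x0 t : 'cV[R]_d := eta *: (Q^T *m Em x0 t).

Let zeS x0 t i : ze x0 t.+1 i 0 = beta1 * ze x0 t i 0 + (1 - beta1) * eta * lam i * xi x0 t i 0.
Proof.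
have -> : ze x0 t.+1 = beta1 *: ze x0 t + ((1 - beta1) * eta) *: (Q^T *m H *m Ey x0 t).
  rewrite /ze /Em (Exv_mS iid) // mulmxDr -!scalemxAr scalerDr !scalerA mulmxA.
  by rewrite [eta * beta1]mulrC [eta * (1 - beta1)]mulrC.
have -> : Q^T *m H *m Ey x0 t = diag_mx (\row_i lam i) *m xi x0 t.
  by rewrite -QH /xi -[RHS]mulmxA (mulmxA Q) PQ mul1mx.
by rewrite mul_diag_mx !mxE; ring.
Qed.

Let xiS x0 t i : xi x0 t.+1 i 0 = xi x0 t i 0 - ze x0 t.+1 i 0.
Proof.
have -> : xi x0 t.+1 = xi x0 t - ze x0 t.+1.
  rewrite /xi /ze /Ey /Em (Exv_yS iid) // mulmxBr -scalemxAr; congr (_ - _ *: _).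
  by rewrite -mulmxA mulKVmx.
by rewrite !mxE.
Qed.

Let Em0 x0 : Em x0 0%N = 0.
Proof.
by apply/colP => i; rewrite !mxE; exact: Ex_cst.
Qed.

Let Ey0 x0 : Ey x0 0%N = x0 - xs.
Proof.
by apply/colP => i; rewrite [LHS]mxE; exact: (Ex_cst P ((x0 - xs) i 0)).
Qed.

Lemma mean_stable : (forall i, 0 <= (1 - beta1) * eta * lam i < 2 * (1 + beta1)) ->
  forall x0, mean_bounded P u fxs H Pc xs eta beta1 mu x0.
Proof.
move=> stab x0; split.
  move=> t i.
  rewrite (expectation_pastRV iid ((pastRV_zoadam u fxs Pc xs eta beta1 x0 symH mu_neq0 t).1 i)).
  by [].
have bnd i : exists M, forall t, xi x0 t i 0 ^+ 2 <= M.
  apply: (@mean_recursion_bounded R beta1 ((1 - beta1) * eta * lam i)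
    (fun t => xi x0 t i 0) (fun t => ze x0 t i 0)) => //.
  by rewrite /ze Em0 mulmx0 scaler0 mxE.
have [M HM] := boolp.choice bnd.
exists (Num.sqrt (\sum_j (\sum_i `|Q j i|) ^+ 2 * \sum_i M i)) => t.
rewrite -/(Exv _ _) -/(zoadam_y _ _ _ _ _ _ _ _ _ _) /enorm ler_wsqrtr //.
apply: ler_sum => j _.
have -> : Exv P (zoadam_y u fxs H Pc xs eta beta1 mu x0 t) = Q *m xi x0 t.
  by rewrite /xi mulmxA PQ mul1mx.
apply: le_trans (sqr_mulmx_le _ _ _) _; rewrite ler_wpM2l ?sqr_ge0 //.
exact: ler_sum.
Qed.

Lemma mean_unstable i : 2 * (1 + beta1) < (1 - beta1) * eta * lam i ->
  ~ forall x0, mean_bounded P u fxs H Pc xs eta beta1 mu x0.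
Proof.
(* Starting on the [i]-th basis vector gives [xi = e_i] at time 0. *)
move=> inst bnd; pose x0 := xs + Q *m delta_mx i 0.
have [_ [M HM]] := bnd x0.
have := @mean_recursion_unbounded R beta1 ((1 - beta1) * eta * lam i)
    (fun t => xi x0 t i 0) (fun t => ze x0 t i 0).
apply => //.
- by rewrite /ze Em0 mulmx0 scaler0 mxE.
- by rewrite /xi Ey0 /x0 addrAC subrr add0r mulmxA QP mul1mx mxE !eqxx.
exists (((\sum_j `|(Q^T *m Pc) i j|) * M) ^+ 2) => t.
rewrite -[leLHS]real_normK ?num_real //.
have h : `|xi x0 t i 0| <= (\sum_j `|(Q^T *m Pc) i j|) * M.
  apply: le_trans (abs_mulmx_le _ _ _) _; rewrite ler_wpM2l ?sumr_ge0 //.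
  exact: (HM t).
by rewrite lerXn2r ?nnegrE //; exact: le_trans h.
Qed.

End mean_stability.

(** * Mean-square stability under commutation *)

Section mean_square_stability.
Context {dT : measure_display} {T : measurableType dT} {R : realType} {d : nat}.
Variables (P : probability T R) (u : nat -> 'I_d -> T -> R).
Hypothesis iid : iid_std_gaussian_dirs P u.
Variables (fxs : R) (H Pc : 'M[R]_d) (xs : 'cV[R]_d) (eta beta1 mu : R) (lam : 'I_d -> R).
Hypothesis symH : trmx H = H.
Hypothesis mu_neq0 : mu != 0.
Hypothesis beta01 : 0 <= beta1 < 1.
Hypothesis eta0 : 0 < eta.
Hypothesis lam_ge0 : forall i, 0 <= lam i.
Hypothesis PcU : Pc \in unitmx.
Hypothesis PcH : Pc *m H = H *m Pc.
Variable O : 'M[R]_d.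
Hypothesis OO : O^T *m O = 1%:M.
Hypothesis OK : O^T *m (invmx Pc *m H) *m O = diag_mx (\row_i lam i).

Local Notation pastRV t := (polyRV (dir_coord u) (past t)).
Local Notation Ex := (Ex P).
Let mX p : measurable_fun setT (dir_coord u p). Proof. by case: iid => h _ _; exact: h. Qed.
Let indX : mutually_independent P (dir_coord u). Proof. by case: iid. Qed.
Let normX p : std_normal P (dir_coord u p). Proof. by case: iid => _ _ h; exact: h. Qed.

Let OOt : O *m O^T = 1%:M. Proof. exact: mulmx1C. Qed.
Let g := (1 - beta1) * eta.

Let Ex_le t A B : pastRV t A -> pastRV t B -> (forall w, A w <= B w) -> Ex A <= Ex B.
Proof.
move=> pA pB AB; rewrite -subr_ge0 -(ExB mX indX normX pB pA).
apply: (Ex_ge0 iid (polyRVB pB pA)) => w; by rewrite subr_ge0.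
Qed.

Let Ex_lin3 t A B C p q r : pastRV t A -> pastRV t B -> pastRV t C ->
  Ex (fun w => p * A w + q * B w + r * C w) = p * Ex A + q * Ex B + r * Ex C.
Proof.
move=> pA pB pC.
rewrite (ExD mX indX normX (polyRVD (polyRVZ p pA) (polyRVZ q pB)) (polyRVZ r pC)).
rewrite (ExD mX indX normX (polyRVZ p pA) (polyRVZ q pB)).
by rewrite (ExZ mX indX normX _ pA) (ExZ mX indX normX _ pB) (ExZ mX indX normX _ pC).
Qed.

Section trajectory.
Variable x0 : 'cV[R]_d.
Let y t w := zoadam_y u fxs H Pc xs eta beta1 mu x0 t w.
Let m t w := zoadam_m u fxs H Pc xs eta beta1 mu x0 t w.
(* Coordinates of [P y] and [eta m] in the orthonormal eigenbasis [O] of [P^-1 H]. *)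
Let yh t w : 'cV[R]_d := O^T *m Pc *m y t w.
Let zh t w : 'cV[R]_d := eta *: (O^T *m m t w).
Let a t k w : R := (H *m y t w) k 0.
(** Coordinate [i] of the gradient estimate in the basis [O], as a product of two projections of
    [u t]. *)
Let G t i w : R := (\sum_k a t k w * u t k w) * (\sum_l O l i * u t l w).

(** Commutation enters here: [H y = P^-1 H (P y)], so [H y] is diagonal in the coordinates of
    [P y]. *)
Let Oa t w i : \sum_k a t k w * O k i = lam i * yh t w i 0.
Proof.
transitivity ((O^T *m (H *m y t w)) i 0).
  by rewrite [RHS]mxE; apply: eq_bigr => k _; rewrite [trmx O i k]mxE mulrC.
have -> : O^T *m (H *m y t w) = diag_mx (\row_i lam i) *m yh t w.
  rewrite -OK /yh -[RHS]mulmxA -(mulmxA O^T Pc) (mulmxA O) OOt mul1mx -!mulmxA.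
  by rewrite (mulmxA H Pc) -PcH -mulmxA mulKmx.
by rewrite mul_diag_mx !mxE.
Qed.

(** Orthonormality of [O] turns the Euclidean norm from [Ex_biquadratic] into a sum over
    eigenvalues, which closes the recursion. *)
Let a_sqr t w : \sum_k a t k w ^+ 2 = \sum_j lam j ^+ 2 * yh t w j 0 ^+ 2.
Proof.
transitivity (((H *m y t w)^T *m (H *m y t w)) 0 0).
  by rewrite dot_col; apply: eq_bigr => k _; rewrite expr2.
have -> : (H *m y t w)^T *m (H *m y t w) =
    (O^T *m (H *m y t w))^T *m (O^T *m (H *m y t w)).
  by move: (H *m y t w) => v; rewrite trmx_mul trmxK -mulmxA (mulmxA O) OOt mul1mx.
rewrite dot_col; apply: eq_bigr => j _.
have -> : (O^T *m (H *m y t w)) j 0 = lam j * yh t w j 0.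
  rewrite -Oa [LHS]mxE; apply: eq_bigr => k _; by rewrite [trmx O j k]mxE mulrC.
by rewrite -expr2 exprMn.
Qed.

Let zhS t w i : zh t.+1 w i 0 = beta1 * zh t w i 0 + g * G t i w.
Proof.
have -> : zh t.+1 w = beta1 *: zh t w + (g * \sum_k a t k w * u t k w) *: (O^T *m dirs_at u w t).
  rewrite /zh /m zoadam_mS // zoadam_slopeE mulmxDr -!scalemxAr scalerDr !scalerA.
  by rewrite [eta * beta1]mulrC /g mulrA [eta * (1 - beta1)]mulrC.
rewrite mxE_addZ; congr (_ + _); rewrite -mulrA /G; congr (_ * (_ * _)).
rewrite mxE; apply: eq_bigr => l _.
by rewrite !mxE.
Qed.

Let yhS t w i : yh t.+1 w i 0 = yh t w i 0 - zh t.+1 w i 0.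
Proof.
have -> : yh t.+1 w = yh t w - zh t.+1 w.
  rewrite /yh /zh /y /m zoadam_yS mulmxBr -scalemxAr; congr (_ - _ *: _).
  by rewrite -mulmxA mulKVmx.
by rewrite !mxE.
Qed.

Let pyt t i : pastRV t (fun w => y t w i 0).
Proof. exact: (pastRV_zoadam u fxs Pc xs eta beta1 x0 symH mu_neq0 t).1. Qed.
Let pyh t i : pastRV t (fun w => yh t w i 0). Proof. exact: pastRV_mulmx. Qed.
Let pzh t i : pastRV t (fun w => zh t w i 0).
Proof.
under eq_fun do rewrite /zh mxE; apply: polyRVZ; apply: pastRV_mulmx => j.
exact: (pastRV_zoadam u fxs Pc xs eta beta1 x0 symH mu_neq0 t).2.
Qed.
Let pat t k : pastRV t (a t k). Proof. exact: pastRV_mulmx. Qed.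
Let pG t i : pastRV t.+1 (G t i).
Proof.
apply: polyRVM; apply: polyRV_sum => k; last by apply: polyRVZ; exact: pastRV_dir.
by apply: polyRVM; [exact: (pastRV_sub (leqnSn t))|exact: pastRV_dir].
Qed.
Let up t Z : pastRV t Z -> pastRV t.+1 Z. Proof. exact: pastRV_sub. Qed.

Let Y t i := Ex (fun w => yh t w i 0 ^+ 2).
Let C t i := Ex (fun w => yh t w i 0 * zh t w i 0).
Let N t i := Ex (fun w => zh t w i 0 ^+ 2).

Let Ex_G t i B : pastRV t B -> Ex (fun w => B w * G t i w) = lam i * Ex (fun w => B w * yh t w i 0).
Proof.
move=> pB; rewrite /G (Ex_bilinear iid _ (pat t) pB).
rewrite -(ExZ mX indX normX _ (polyRVM pB (pyh t i))); congr Ex; apply/funext => w.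
by rewrite Oa mulrCA.
Qed.

Let Ex_G2 t i : Ex (fun w => G t i w ^+ 2) =
  \sum_j lam j ^+ 2 * Y t j + 2 * (lam i ^+ 2 * Y t i).
Proof.
have py2 j : pastRV t (fun w => yh t w j 0 ^+ 2) by exact: (polyRVM (pyh t j) (pyh t j)).
rewrite /G (Ex_biquadratic iid _ (pat t)).
have -> : \sum_l O l i ^+ 2 = 1.
  have := congr1 (fun A : 'M[R]_d => A i i) OO; rewrite !mxE eqxx mulr1n => <-.
  by apply: eq_bigr => l _; rewrite mxE expr2.
rewrite mulr1; congr (_ + _ * _).
  transitivity (Ex (fun w => \sum_j lam j ^+ 2 * yh t w j 0 ^+ 2)).
    by congr Ex; apply/funext => w; rewrite a_sqr.
  rewrite (Ex_sum mX indX normX (D := past t)); last by move=> j; exact: polyRVZ.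
  by apply: eq_bigr => j _; rewrite (ExZ mX indX normX _ (py2 j)).
rewrite -(ExZ mX indX normX _ (py2 i)); congr Ex; apply/funext => w.
by rewrite Oa exprMn.
Qed.

Let NS t i : N t.+1 i = beta1 ^+ 2 * N t i + 2 * beta1 * g * lam i * C t i
  + g ^+ 2 * (2 * lam i ^+ 2 * Y t i + \sum_j lam j ^+ 2 * Y t j).
Proof.
transitivity (Ex (fun w => beta1 ^+ 2 * zh t w i 0 ^+ 2 +
    (2 * beta1 * g) * (zh t w i 0 * G t i w) + g ^+ 2 * G t i w ^+ 2)).
  by congr Ex; apply/funext => w; rewrite zhS; ring.
rewrite (@Ex_lin3 t.+1).
- rewrite (Ex_G _ (pzh t i)) Ex_G2 /N /C.
  have -> : Ex (fun w => zh t w i 0 * yh t w i 0) = Ex (fun w => yh t w i 0 * zh t w i 0).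
    by congr Ex; apply/funext => w; rewrite mulrC.
  ring.
- by apply: up; exact: (polyRVM (pzh t i) (pzh t i)).
- by apply: polyRVM => //; exact: up.
- exact: (polyRVM (pG t i) (pG t i)).
Qed.

Let Ex_yz t i : Ex (fun w => yh t w i 0 * zh t.+1 w i 0) = beta1 * C t i + g * lam i * Y t i.
Proof.
transitivity (Ex (fun w => beta1 * (yh t w i 0 * zh t w i 0) +
    g * (yh t w i 0 * G t i w) + 0 * 1)).
  by congr Ex; apply/funext => w; rewrite zhS; ring.
rewrite (@Ex_lin3 t.+1 _ _ (fun=> 1)).
- rewrite (Ex_G _ (pyh t i)) /Y /C mul0r addr0 mulrA; congr (_ + _ * _).
- by apply: up; exact: (polyRVM (pyh t i) (pzh t i)).
- by apply: polyRVM => //; exact: up.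
- exact: polyRV_cst.
Qed.

Let CS t i : C t.+1 i = beta1 * C t i + g * lam i * Y t i - N t.+1 i.
Proof.
rewrite -Ex_yz.
rewrite -(ExB mX indX normX (polyRVM (up (pyh t i)) (pzh t.+1 i))
   (polyRVM (pzh t.+1 i) (pzh t.+1 i))).
by congr Ex; apply/funext => w; rewrite yhS; ring.
Qed.

Let YS t i : Y t.+1 i = Y t i - 2 * (beta1 * C t i + g * lam i * Y t i) + N t.+1 i.
Proof.
rewrite -Ex_yz.
transitivity (Ex (fun w => 1 * yh t w i 0 ^+ 2 + (- 2) * (yh t w i 0 * zh t.+1 w i 0)
    + 1 * zh t.+1 w i 0 ^+ 2)).
  by congr Ex; apply/funext => w; rewrite yhS; ring.
rewrite (@Ex_lin3 t.+1).
- by rewrite /Y /N; ring.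
- by apply: up; exact: (polyRVM (pyh t i) (pyh t i)).
- exact: (polyRVM (up (pyh t i)) (pzh t.+1 i)).
- exact: (polyRVM (pzh t.+1 i) (pzh t.+1 i)).
Qed.

Let psdYN t i (p q : R) : 0 <= p ^+ 2 * N t i + 2 * p * q * C t i + q ^+ 2 * Y t i.
Proof.
have pz2 := polyRVM (pzh t i) (pzh t i); have py2 := polyRVM (pyh t i) (pyh t i).
have pyz := polyRVM (pyh t i) (pzh t i).
rewrite -(Ex_lin3 _ _ _ pz2 pyz py2); apply: (Ex_ge0 iid (t := t)).
  by apply: polyRVD; [apply: polyRVD|]; apply: polyRVZ.
move=> w; have := sqr_ge0 (p * zh t w i 0 + q * yh t w i 0).
by congr (_ <= _); ring.
Qed.

Let N0 i : N 0%N i = 0.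
Proof.
rewrite -[RHS](Ex_cst P 0); congr Ex; apply/funext => w.
by rewrite /zh /m /zoadam_m /= mulmx0 scaler0 mxE expr0n.
Qed.

Let C0 i : C 0%N i = 0.
Proof.
rewrite -[RHS](Ex_cst P 0); congr Ex; apply/funext => w.
by rewrite /zh /m /zoadam_m /= mulmx0 scaler0 [X in _ * X]mxE mulr0.
Qed.

Let expect_enorm t : ('E_P[(fun w => enorm (zoadam_x u fxs H Pc xs eta beta1 mu x0 t w - xs) ^+ 2)%R]
   = (Ex (fun w => \sum_j y t w j 0 ^+ 2)%R)%:E)%E.
Proof.
rewrite -(expectation_pastRV iid (t := t)).
  by congr expectation; apply/funext => w; rewrite enorm_sqr.
by apply: polyRV_sum => j; exact: (polyRVM (pyt t j) (pyt t j)).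
Qed.

Let psum t : pastRV t (fun w => \sum_j y t w j 0 ^+ 2).
Proof. by apply: polyRV_sum => j; exact: (polyRVM (pyt t j) (pyt t j)). Qed.

Let psumh t : pastRV t (fun w => \sum_j yh t w j 0 ^+ 2).
Proof. by apply: polyRV_sum => j; exact: (polyRVM (pyh t j) (pyh t j)). Qed.

Let ms_bounded_of : (exists M, forall t i, Y t i <= M) ->
  ms_bounded P u fxs H Pc xs eta beta1 mu x0.
Proof.
move=> [M HM].
pose c := \sum_j (\sum_i `|(invmx Pc *m O) j i|) ^+ 2.
have c0 : 0 <= c by apply: sumr_ge0 => j _; exact: sqr_ge0.
exists (c * \sum_(i < d) M) => t; rewrite expect_enorm lee_fin.
apply: (@le_trans _ _ (Ex (fun w => c * \sum_j yh t w j 0 ^+ 2))).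
  apply: (Ex_le (psum t) (polyRVZ c (psumh t))) => w.
  rewrite mulr_suml; apply: ler_sum => j _.
  have -> : y t w = invmx Pc *m O *m yh t w.
    by rewrite /yh mulmxA -(mulmxA (invmx Pc)) (mulmxA O) OOt mul1mx mulVmx // mul1mx.
  exact: sqr_mulmx_le.
rewrite (ExZ mX indX normX _ (psumh t)) ler_wpM2l //.
rewrite (Ex_sum mX indX normX (D := past t)); first by apply: ler_sum => j _; exact: HM.
by move=> j; exact: (polyRVM (pyh t j) (pyh t j)).
Qed.

Let of_ms_bounded : ms_bounded P u fxs H Pc xs eta beta1 mu x0 ->
  exists M, forall t i, Y t i <= M.
Proof.
move=> [M HM].
pose c i := (\sum_j `|(O^T *m Pc) i j|) ^+ 2.
have c0 i : 0 <= c i by exact: sqr_ge0.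
have HM' t : Ex (fun w => \sum_j y t w j 0 ^+ 2) <= M by rewrite -lee_fin -expect_enorm.
have M0 : 0 <= M.
  apply: le_trans (HM' 0%N); apply: (Ex_ge0 iid (psum 0)) => w.
  by apply: sumr_ge0 => j _; exact: sqr_ge0.
exists ((\sum_i c i) * M) => t i.
apply: (@le_trans _ _ (Ex (fun w => c i * \sum_j y t w j 0 ^+ 2))).
  apply: (Ex_le (polyRVM (pyh t i) (pyh t i)) (polyRVZ _ (psum t))) => w.
  by rewrite -expr2; exact: sqr_mulmx_le.
rewrite (ExZ mX indX normX _ (psum t)).
apply: (@le_trans _ _ (c i * M)); first by rewrite ler_wpM2l.
rewrite ler_wpM2r // (bigD1 i) //= lerDl.
exact: sumr_ge0.
Qed.

Lemma ms_stable : (forall i, eta * lam i < 1 + beta1) -> ms_sum lam beta1 eta < 1 ->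
  ms_bounded P u fxs H Pc xs eta beta1 mu x0.
Proof.
move=> small F1; apply: ms_bounded_of.
exact: (second_moments_bounded beta01 eta0 lam_ge0 N0 NS CS YS psdYN small F1).
Qed.

Lemma ms_unstable_at i : 0 < lam i -> 0 < (O^T *m Pc *m (x0 - xs)) i 0 ->
  1 + beta1 <= eta * lam i \/
    (forall i, eta * lam i < 1 + beta1) /\ 1 < ms_sum lam beta1 eta ->
  ~ ms_bounded P u fxs H Pc xs eta beta1 mu x0.
Proof.
move=> li y0 inst /of_ms_bounded bnd.
have Y0 : 0 < Y 0%N i.
  rewrite /Y (_ : (fun w => _) = (fun=> (O^T *m Pc *m (x0 - xs)) i 0 ^+ 2)) //.
  by rewrite Ex_cst exprn_gt0.
case: inst => [big|[small F1]]; move: bnd.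
  exact: (second_moments_unbounded_max beta01 eta0 lam_ge0 N0 C0 NS CS YS psdYN li Y0 big).
exact: (second_moments_unbounded_sum beta01 eta0 lam_ge0 N0 C0 NS CS YS psdYN small li Y0 F1).
Qed.

End trajectory.

Lemma ms_unstable i : 0 < lam i ->
  1 + beta1 <= eta * lam i \/
    (forall i, eta * lam i < 1 + beta1) /\ 1 < ms_sum lam beta1 eta ->
  ~ forall x0, ms_bounded P u fxs H Pc xs eta beta1 mu x0.
Proof.
move=> li inst bnd.
(* Chosen so that [P y_0 = O e_i], hence [yh = e_i] at time 0. *)
apply: (@ms_unstable_at (xs + invmx Pc *m (O *m delta_mx i 0)) i li _ inst (bnd _)).
rewrite addrAC subrr add0r -(mulmxA O^T) mulKVmx // mulmxA OO mul1mx mxE !eqxx.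
exact: ltr01.
Qed.

End mean_square_stability.

(** * Critical step sizes *)

(** Membership of [e] is left open, so stability at the critical step size never has to be
    decided. *)
Lemma sup_threshold (R : realType) (A : set R) (e : R) : 0 < e ->
  (forall x, 0 < x < e -> A x) -> (forall x, A x -> x <= e) -> sup A = e.
Proof.
move=> e0 Ain Aub; apply/eqP; rewrite eq_le; apply/andP; split.
  apply: ge_sup; last by move=> x /Aub.
  by exists (e / 2); apply: Ain; apply/andP; split; lra.
apply/ler_addgt0Pl => h h0; rewrite -lerBlDl.
(* If [e - h] is not positive it need not belong to [A], and [e / 2] is used instead. *)
have [hE|hE] := leP e h.
  apply: (@le_trans _ _ 0); first by rewrite subr_le0.
  apply: (@le_trans _ _ (e / 2)); first by lra.
  apply: ub_le_sup; first by exists e => x /Aub.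
  by apply: Ain; apply/andP; split; lra.
apply: ub_le_sup; first by exists e => x /Aub.
by apply: Ain; apply/andP; split; lra.
Qed.

Section lam_max.
Variables (R : realType) (d : nat) (lam : 'I_d -> R).

Lemma le_lam_max i : lam i <= lam_max lam.
Proof. exact: le_bigmax. Qed.

(** The maximum starts from the default 0; positivity rules out that the default is the value. *)
Lemma lam_max_attained : 0 < lam_max lam -> exists i, lam_max lam = lam i.
Proof.
move=> m0.
have : lam_max lam = 0 \/ exists i, lam_max lam = lam i.
  rewrite /lam_max; elim/big_ind: _ => [|x y hx hy|i _]; [by left| |by right; exists i].
  by case: leP.
by case=> // m00; move: m0; rewrite m00 ltxx.
Qed.

End lam_max.

Section ms_sum.
Variables (R : realType) (d : nat) (lam : 'I_d -> R) (b : R).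
Hypothesis lam_ge0 : forall i, 0 <= lam i.
Hypothesis lmax0 : 0 < lam_max lam.
Hypothesis b0 : 0 <= b.

Let bp : 0 < 1 + b. Proof. by rewrite ltr_pwDl. Qed.

Let term (l eta : R) := eta * l / (2 * (1 - eta * l / (1 + b))).

Let den_gt0 l eta : eta * l < 1 + b -> 0 < 2 * (1 - eta * l / (1 + b)).
Proof. by move=> h; rewrite mulr_gt0 // subr_gt0 ltr_pdivrMr // mul1r. Qed.

Let small_of eta i : 0 < eta -> eta * lam_max lam < 1 + b -> eta * lam i < 1 + b.
Proof. by move=> e0; apply: le_lt_trans; rewrite ler_pM2l // le_lam_max. Qed.

Let term_le l eta eta' : 0 <= l -> 0 < eta -> eta <= eta' -> eta' * l < 1 + b ->
  term l eta <= term l eta'.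
Proof.
move=> l0 e0 ee s; have sl : eta * l <= eta' * l by rewrite ler_wpM2r.
have s' : eta * l < 1 + b by exact: le_lt_trans s.
rewrite /term ler_pM ?mulr_ge0 ?invr_ge0 ?(ltW (den_gt0 s')) ?(ltW e0) //.
rewrite lef_pV2 ?posrE ?den_gt0 // ler_pM2l // lerB // ler_pM2r ?invr_gt0 //.
Qed.

Let term_lt l eta eta' : 0 < l -> 0 < eta -> eta < eta' -> eta' * l < 1 + b ->
  term l eta < term l eta'.
Proof.
move=> l0 e0 ee s; have sl : eta * l < eta' * l by rewrite ltr_pM2r.
have s' : eta * l < 1 + b by exact: lt_trans s.
rewrite /term ltr_pM ?mulr_ge0 ?invr_ge0 ?(ltW (den_gt0 s')) ?(ltW e0) ?(ltW l0) //.
rewrite ltf_pV2 ?posrE ?den_gt0 // ltr_pM2l // ltrD2l ltrN2 ltr_pM2r ?invr_gt0 //.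
Qed.

(** Each summand is monotone before its pole, and the one of a largest eigenvalue strictly so. *)
Lemma ms_sum_lt eta eta' : 0 < eta -> eta < eta' -> eta' * lam_max lam < 1 + b ->
  ms_sum lam b eta < ms_sum lam b eta'.
Proof.
move=> e0 ee s; have [i iE] := lam_max_attained lmax0.
have e0' : 0 < eta' by exact: lt_trans ee.
rewrite /ms_sum (bigD1 i) //= [ltRHS](bigD1 i) //=; apply: ltr_leD.
  by apply: term_lt => //; [rewrite -iE|exact: small_of].
by apply: ler_sum => j _; apply: term_le => //; [exact: ltW|exact: small_of].
Qed.

Lemma ms_sum_root : exists2 e, 0 < e & e * lam_max lam < 1 + b /\ ms_sum lam b e = 1.
Proof.
have [i iE] := lam_max_attained lmax0.
have b3 : 0 < 3 + b by rewrite ltr_pwDl.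
(* [2 (1 + b) / (3 + b)] is the value of [eta * lam_max lam] at which the summand of the largest
   eigenvalue alone equals 1; the root is then found on an interval that avoids the poles. *)
have b23 : 2 * (1 + b) / (3 + b) < 1 + b.
  rewrite ltr_pdivrMr // [ltLHS]mulrC (ltr_pM2l bp).
  by apply: (@lt_le_trans _ _ 3); [rewrite ltr_nat|rewrite lerDl].
pose h := 2 * (1 + b) / (3 + b) / lam_max lam.
have h0 : 0 < h by rewrite !divr_gt0 ?mulr_gt0.
have hl : h * lam_max lam = 2 * (1 + b) / (3 + b) by rewrite divfK // gt_eqF.
have hs : h * lam_max lam < 1 + b.
  by rewrite hl.
have small x j : 0 <= x <= h -> x * lam j < 1 + b.
  move=> /andP[x0 xh]; apply: le_lt_trans hs.
  by apply: ler_pM => //; exact: le_lam_max.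
have F0 : ms_sum lam b 0 = 0 by rewrite /ms_sum big1 // => j _; rewrite !mul0r.
have Fh : 1 <= ms_sum lam b h.
  rewrite /ms_sum (bigD1 i) //= -iE hl.
  have -> : 2 * (1 + b) / (3 + b) / (2 * (1 - 2 * (1 + b) / (3 + b) / (1 + b))) = 1.
    by field; rewrite ?gt_eqF //=; lra.
  rewrite lerDl; apply: sumr_ge0 => j _.
  apply: divr_ge0; first by rewrite mulr_ge0 // ltW.
  by apply/ltW/den_gt0/small; rewrite lexx ltW.
have cF : {within `[0, h], continuous (ms_sum lam b)}.
  apply: continuous_in_subspaceT => x; rewrite inE /= in_itv /= => xh.
  rewrite /continuous_at /ms_sum; elim: (index_enum _) => [|j r IHr].
    by under eq_fun do rewrite big_nil; rewrite big_nil; exact: cvg_cst.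
  under eq_fun do rewrite big_cons; rewrite big_cons; apply: cvgD; last exact: IHr.
  have cm : eta * lam j @[eta --> x] --> x * lam j by apply: cvgMl; exact: cvg_id.
  apply: cvgM => //; apply: cvgV; first by rewrite gt_eqF // den_gt0 // small.
  apply: cvgMr; apply: cvgB; first exact: cvg_cst.
  exact: cvgMl.
have [|e] := @IVT R (ms_sum lam b) 0 h 1 (ltW h0) cF.
  by rewrite F0 ge_min ler01 /= le_max Fh orbT.
rewrite in_itv /= => /andP[e0 eh] eF.
have en : e != 0 by apply: contra_eq_neq eF => ->; rewrite F0 eq_sym oner_neq0.
exists e; first by rewrite lt_neqAle eq_sym en.
by split=> //; apply: le_lt_trans hs; rewrite ler_pM2r.
Qed.

(** In the lower bound every denominator is replaced by that of the largest eigenvalue, in the upper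
    bound by 2. *)
Lemma ms_sum_root_bounds e : 0 < e -> e * lam_max lam < 1 + b -> ms_sum lam b e = 1 ->
  2 / (\sum_i lam i + 2 * lam_max lam / (1 + b)) <= e <= 2 / \sum_i lam i.
Proof.
move=> e0 es eF; have [i iE] := lam_max_attained lmax0.
have S0 : 0 < \sum_i lam i.
  by rewrite (bigD1 i) //= -iE ltr_pwDl // sumr_ge0.
have D0 := den_gt0 es.
have es' j : e * lam j < 1 + b by exact: small_of.
apply/andP; split.
  rewrite ler_pdivrMr; last by rewrite ltr_wpDr // divr_ge0 ?mulr_ge0 // ltW.
  have : 1 <= e * (\sum_i lam i) / (2 * (1 - e * lam_max lam / (1 + b))).
    rewrite -[leLHS]eF mulr_sumr mulr_suml; apply: ler_sum => j _.
    apply: ler_wpM2l; first by rewrite mulr_ge0 // ltW.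
    rewrite lef_pV2 ?posrE ?den_gt0 // ler_pM2l // lerB //.
    by rewrite ler_pM2r ?invr_gt0 // ler_pM2l // le_lam_max.
  rewrite ler_pdivlMr // mul1r; lra.
rewrite ler_pdivlMr //.
have : 2^-1 * (e * \sum_i lam i) <= 1; last by lra.
rewrite -[leRHS]eF !mulr_sumr; apply: ler_sum => j _.
rewrite mulrC; apply: ler_wpM2l; first by rewrite mulr_ge0 // ltW.
rewrite lef_pV2 ?posrE ?den_gt0 // ler_piMr //.
by rewrite gerBl divr_ge0 ?mulr_ge0 // ltW.
Qed.

End ms_sum.

Theorem theorem4p10 (R : realType) (d : nat)
  (f : 'cV[R]_d -> R) (xs : 'cV[R]_d) (H Pc : 'M[R]_d) (lam : 'I_d -> R)
  (beta1 mu : R) (dT : measure_display) (T : measurableType dT)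
  (P : probability T R) (u : nat -> 'I_d -> T -> R) :
  local_minimizer f xs ->
  twice_diff_near f xs ->
  H = hessian f xs ->
  psd H -> H != 0 ->
  spd Pc ->
  char_poly (invmx Pc *m H) = \prod_(i < d) ('X - (lam i)%:P) ->
  (forall i j : 'I_d, (i <= j)%N -> lam j <= lam i) ->
  0 <= beta1 < 1 -> 0 < mu ->
  iid_std_gaussian_dirs P u ->
  eta_crit_mean P u (f xs) H Pc xs beta1 mu
    = 2 * (1 + beta1) / ((1 - beta1) * lam_max lam)
  /\
  (Pc *m H = H *m Pc ->
   let e := eta_crit_ms P u (f xs) H Pc xs beta1 mu in
   [/\ 0 < e, e * lam_max lam < 1 + beta1, ms_sum lam beta1 e = 1,
       (forall eta : R, 0 < eta -> eta * lam_max lam < 1 + beta1 ->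
          ms_sum lam beta1 eta = 1 -> eta = e)
     & 2 / (\tr (invmx Pc *m H) + 2 * lam_max lam / (1 + beta1)) <= e
       <= 2 / \tr (invmx Pc *m H)]).
Proof.
move=> _ tw HE psdH Hn0 [symP posP] chK _ b01 mu0 iid.
have /andP[b0 b1] := b01.
have symH : H^T = H by rewrite HE hessian_sym.
have muN : mu != 0 by rewrite gt_eqF.
have [Q QP QH] := spd_sym_diagonalization symP posP symH chK.
have PQ : Q *m (Q^T *m Pc) = 1%:M by exact: mulmx1C.
have PcU : Pc \in unitmx.
  have : \det (Q^T *m Pc *m Q) \is a GRing.unit by rewrite QP det1 unitr1.
  by rewrite !det_mulmx !unitrM => /andP[/andP[]].
have PV : invmx Pc = Q *m Q^T by rewrite -[LHS]mul1mx -PQ mulmxA mulmxK.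
have lam_ge0 i : 0 <= lam i.
  have qE (v : 'cV[R]_d) : qform H (Q *m v) = (v^T *m (Q^T *m H *m Q) *m v) 0 0.
    by rewrite /qform trmx_mul !mulmxA.
  have := psdH (Q *m delta_mx i 0).
  by rewrite qE QH trmx_delta -rowE -colE !mxE eqxx mulr1n.
have lmax0 : 0 < lam_max lam.
  (* If the maximum were 0, all [lam i] would vanish and undoing the congruence by [Q] would give
     [H = 0]. *)
  rewrite lt_neqAle /lam_max bigmax_ge_id andbT; apply: contra Hn0 => /eqP m0.
  have lam0 i : lam i = 0 by apply: le_anti; rewrite lam_ge0 andbT m0; exact: le_lam_max.
  have D0 : diag_mx (\row_i lam i) = 0.
    by apply/matrixP => i j; rewrite !mxE lam0 mul0rn.
  have PQ' : Pc *m Q *m Q^T = 1%:M by rewrite -mulmxA -PV mulmxV.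
  have -> : H = Pc *m Q *m (Q^T *m H *m Q) *m (Q^T *m Pc).
    by rewrite -!mulmxA (mulmxA Q) PQ mulmx1 !mulmxA PQ' mul1mx.
  by rewrite QH D0 mulmx0 mul0mx.
have trE : \tr (invmx Pc *m H) = \sum_i lam i.
  rewrite PV -mulmxA mxtrace_mulC QH mxtrace_diag.
  by apply: eq_bigr => i _; rewrite mxE.
have [i0 i0E] := lam_max_attained lmax0.
have b1m : 0 < 1 - beta1 by rewrite subr_gt0.
have bp : 0 < 1 + beta1 by rewrite ltr_pwDl.
have cmax : 0 < (1 - beta1) * lam_max lam by rewrite mulr_gt0.
split.
  apply: sup_threshold; first by rewrite divr_gt0 ?mulr_gt0.
    move=> eta /andP[eta0]; rewrite ltr_pdivlMr // => small; split=> //.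
    apply: (mean_stable iid _ _ symH muN b01 QP QH) => i.
    rewrite !mulr_ge0 ?(ltW b1m) ?(ltW eta0) //=; apply: le_lt_trans small.
    rewrite [leRHS]mulrCA -[leLHS]mulrA ler_pM2l // ler_pM2l //.
    exact: le_lam_max.
  move=> eta [eta0 bnd]; rewrite leNgt; apply/negP => big.
  apply: (mean_unstable iid symH muN b01 QP QH (i := i0)) bnd.
  move: big; rewrite ltr_pdivrMr // -i0E => /lt_le_trans; apply.
  by rewrite mulrCA mulrA.
move=> PcH.
(* Commutation makes [P^-1 H] itself symmetric, which provides an orthonormal eigenbasis with the
   same [lam]. *)
have symK : (invmx Pc *m H)^T = invmx Pc *m H.
  rewrite trmx_mul trmx_inv symH symP.
  by rewrite -[LHS]mul1mx -(mulVmx PcU) -mulmxA (mulmxA Pc) PcH mulmxK.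
have [V VV VK] := sym_diagonalization symK chK.
have [e e0 [es eF]] := ms_sum_root lam_ge0 lmax0 b0.
have -> : eta_crit_ms P u (f xs) H Pc xs beta1 mu = e.
  apply: sup_threshold => //.
    move=> eta /andP[eta0 ee]; split=> // x0.
    apply: (ms_stable iid _ _ symH muN b01 eta0 lam_ge0 PcU PcH VV VK).
      move=> i; apply: le_lt_trans es; apply: ler_pM => //; [exact: ltW|exact: ltW|].
      exact: le_lam_max.
    by rewrite -eF; apply: (ms_sum_lt lam_ge0 lmax0 b0).
  move=> eta [eta0 bnd]; rewrite leNgt; apply/negP => big.
  apply: (ms_unstable iid symH muN b01 eta0 lam_ge0 PcU PcH VV VK (i := i0)) bnd.
    by rewrite -i0E.
  (* Beyond [e], either the top eigenvalue has reached its pole or strict monotonicity pushes the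
     sum above 1. *)
  have [h|h] := leP (1 + beta1) (eta * lam i0); first by left.
  right; split.
    by move=> i; apply: le_lt_trans h; rewrite ler_pM2l // -i0E le_lam_max.
  by rewrite -eF; apply: (ms_sum_lt lam_ge0 lmax0 b0) => //; rewrite i0E.
split=> //.
  move=> eta eta0 etas etaF.
  have [lt|gt|//] := ltgtP eta e.
    by have := ms_sum_lt lam_ge0 lmax0 b0 eta0 lt es; rewrite eF etaF ltxx.
  by have := ms_sum_lt lam_ge0 lmax0 b0 e0 gt etas; rewrite eF etaF ltxx.
by rewrite trE; exact: (ms_sum_root_bounds lam_ge0 lmax0 b0).
Qed.
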